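(* Let $X$ be either $\ell_1$ or $F\oplus F'$ with $F$ a non-reflexive Banach space, and let $z\in X''$. If $\tilde\delta_z\ast\tilde\delta_u=\tilde\delta_u\ast\tilde\delta_z$ for all $u\in X''$, then $z\in X$ (i.e. $z$ belongs to the canonical image of $X$ in $X''$).
   Context: $\mathcal{H}_b(X)$ denotes the Fréchet algebra of entire functions of bounded type on $X$; $\mathcal{M}_b(X)$ is its spectrum (nonzero continuous algebra homomorphisms to $\mathbb{C}$). For $f\in\mathcal{H}_b(X)$, $\tilde f\in\mathcal{H}_b(X'')$ is its Aron–Berner extension (multilinear forms are extended by iterated weak-star limits $\tilde A(z_1,\dots,z_m)=\lim_{\alpha_1}\cdots\lim_{\alpha_m}A(x_{\alpha_1},\dots,x_{\alpha_m})$, $x_{\alpha_i}\to z_i$ weak-star, limits from right to left; polynomials through their symmetric multilinear forms; functions termwise in their Taylor series at $0$), and $\tilde\delta_{z}(f)=\tilde f(z)$ for $z\in X''$. The convolution of $\varphi,\psi\in\mathcal{M}_b(X)$ is $\varphi\ast\psi(f)=\varphi\big(x\mapsto\psi(\tau_x f)\big)$, where $\tau_xf(y)=f(y+x)$. *)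

(* Defs.v *)
From HB Require Import structures.
From mathcomp Require Import all_boot all_order all_algebra.
From mathcomp Require Import all_classical all_reals all_analysis.
From mathcomp Require Export complex.
Import Order.TTheory GRing.Theory Num.Theory.
Import numFieldNormedType.Exports.

Set Implicit Arguments.
Unset Strict Implicit.
Unset Printing Implicit Defensive.

Local Open Scope ring_scope.

(* The complex scalar field C = R[i], viewed (via ^o) as a normed/topological
   space over itself so that limits and series of complex numbers make sense. *)
Notation CC R := ((R[i])^o).

Section Banach_duality.
Context {R : realType} {V : normedModType R[i]}.

Definition blf (phi : V -> CC R) : Prop :=
  (forall (a : R[i]) (x y : V), phi (a *: x + y) = a *: phi x + phi y) /\
  exists M : R[i], forall x : V, `|phi x| <= M * `|x|.

Definition is_opnorm (phi : V -> CC R) (N : R[i]) : Prop :=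
  (forall y : V, `|phi y| <= N * `|y|) /\
  (forall M : R[i], (forall y : V, `|phi y| <= M * `|y|) -> N <= M).

(* elements of the bidual V'': bounded linear functionals on V'
   (only their values on elements of V' are meaningful) *)
Definition bidual (z : (V -> CC R) -> CC R) : Prop :=
  (forall (a : R[i]) (phi psi : V -> CC R), blf phi -> blf psi ->
     z (fun x => a *: phi x + psi x) = a *: z phi + z psi) /\
  exists M : R[i], forall (phi : V -> CC R) (N : R[i]), blf phi ->
     (forall x : V, `|phi x| <= N * `|x|) -> `|z phi| <= M * N.

Definition in_canonical_image (z : (V -> CC R) -> CC R) : Prop :=
  exists x : V, forall phi : V -> CC R, blf phi -> z phi = phi x.

Definition non_reflexive : Prop :=
  exists z : (V -> CC R) -> CC R, bidual z /\ ~ in_canonical_image z.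

End Banach_duality.

Section Holomorphy.
Context {R : realType} {X : normedModType R[i]}.

Local Notation bid := ((X -> CC R) -> CC R).

Definition Hb (f : X -> CC R) : Prop :=
  (forall x : X, differentiable f x) /\
  (forall r : R[i], exists M : R[i], forall x : X, `|x| <= r -> `|f x| <= M).

Definition iterD (f : X -> CC R) (xs : seq X) : X -> CC R :=
  foldr (fun v g => fun a => derive g a v) f xs.

(* Aron--Berner extension of an m-linear form A (given as a function of the
   list of its m arguments) evaluated at (z1,...,zm) in X'':
   tilde A(z1,...,zm) = lim_{a1} ... lim_{am} A(x_{a1},...,x_{am}),
   the limits taken from right to left; unfolding the weak-star limits,
   the innermost limit is z_m applied to x_m |-> A(x1,...,x_{m-1},x_m), etc. *)
Fixpoint AB (zs : seq bid) (A : seq X -> CC R) : CC R :=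
  match zs with
  | [::] => A [::]
  | z :: zs' => z (fun x => AB zs' (fun xs => A (x :: xs)))
  end.

(* Aron--Berner extension of f, termwise on its Taylor series at 0:
   P_m = \check A_m with A_m = d^m f(0) / m! the symmetric m-linear form,
   and tilde f(z) = sum_m tilde A_m(z,...,z). *)
Definition AB_ext (f : X -> CC R) (z : bid) : CC R :=
  limn (series (fun m : nat => (m`!%:R)^-1 *: AB (nseq m z) (fun xs => iterD f xs 0))).

Definition tdelta (z : bid) : (X -> CC R) -> CC R := fun f => AB_ext f z.

Definition transl (x : X) (f : X -> CC R) : X -> CC R := fun y => f (y + x).

Definition convolution (phi psi : (X -> CC R) -> CC R) : (X -> CC R) -> CC R :=
  fun f => phi (fun x => psi (transl x f)).

End Holomorphy.

Definition is_ell1 {R : realType} (X : normedModType R[i]) : Prop :=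
  exists T : X -> nat -> CC R,
    (forall (a : R[i]) (x y : X), T (a *: x + y) = (fun n => a *: T x n + T y n)) /\
    (forall x : X, cvgn (series (fun n => (`|T x n| : CC R))) /\
                   (`|x| : CC R) = limn (series (fun n => (`|T x n| : CC R)))) /\
    (forall s : nat -> CC R, cvgn (series (fun n => (`|s n| : CC R))) ->
       exists x : X, T x = s).

(* X is (isometrically isomorphic to) F (+) F' with the sum norm
   ||(y, phi)|| = ||y|| + ||phi|| *)
Definition is_sum_with_dual {R : realType} (X : normedModType R[i])
    (F : normedModType R[i]) : Prop :=
  exists T : X -> F * (F -> CC R),
    (forall (a : R[i]) (x y : X),
        T (a *: x + y) = (a *: (T x).1 + (T y).1,
                          fun w => a *: (T x).2 w + (T y).2 w)) /\
    (forall x : X, blf (T x).2 /\ is_opnorm (T x).2 (`|x| - `|(T x).1|)) /\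
    (forall (y : F) (phi : F -> CC R), blf phi -> exists x : X, T x = (y, phi)).

(* Main.v *)
Require Import Defs.
From HB Require Import structures.
From mathcomp Require Import all_boot all_order all_algebra.
From mathcomp Require Import all_classical all_reals all_analysis.
From mathcomp Require Import complex.
From mathcomp Require Import ring lra.
Import Order.TTheory GRing.Theory Num.Theory.
Import numFieldNormedType.Exports.
Local Open Scope ring_scope.

(* For a bounded symmetric bilinear form B, evaluating the two convolutions at
   the polynomial B(x, x) shows that commutation with u forces
   z_x u_y B(x, y) = u_x z_y B(x, y); each case is settled by a good choice of B.

   On F (+) F', take B((a, f), (b, g)) = f(b) + g(a) and write z = (z1, z2) with
   z1 in F'' and z2 in F'''. Letting u = (0, u2) gives u2(z1) = z1(u2 o J), where
   J : F -> F'' is the canonical map; a u2 annihilating the closed subspace J(F)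
   but not z1 cannot exist, so z1 lies in J(F). Letting u = (u1, 0) gives
   z2(u1) = u1(z2 o J), so z2 is the canonical image of z2 o J.

   On l_1, subtract from z the element x0 = (z(coordinate n))_n: the difference w
   vanishes on c_0. Take B(x, y) = phi(x * y), where * is the convolution of the
   semigroup (nat, max), so that e_i * e_j = e_j for i < j. If u vanishes on c_0
   too, then u_y B(e_i, y) = u(phi) for all i, and commutation reads
   w(1) u(phi) = w(phi) u(1). Two generalized limits u, along the even and along
   the odd integers, tested on the indicator of the even integers, force
   w(1) = 0, hence w = 0. *)

Set Implicit Arguments.
Unset Strict Implicit.
Unset Printing Implicit Defensive.

Local Notation Re := complex.Re.
Local Notation iterD := Defs.iterD.

(** * Complex Hahn-Banach theorem *)

Section Hahn_Banach_real.
Local Open Scope complex_scope.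
Context {R : realType} {V : lmodType R[i]}.
Variable D : V -> Prop.
Hypothesis D0 : D 0.
Hypothesis DL : forall (a : R[i]) v w, D v -> D w -> D (a *: v + w).

(** Only real scalars act here, and [D] stands for a subspace. Homogeneity is an inequality, which
    is easier to check for infima; equality is recovered in [sublinearZ]. *)
Definition sublinear_on (q : V -> R) : Prop :=
  (forall v w, D v -> D w -> q (v + w) <= q v + q w) /\
  (forall (a : R) v, 0 <= a -> D v -> q (a%:C *: v) <= a * q v).

Lemma domD v w : D v -> D w -> D (v + w).
Proof. by move=> Dv Dw; rewrite -[v]scale1r; exact: DL. Qed.

Lemma domZ (a : R[i]) v : D v -> D (a *: v).
Proof. by move=> Dv; rewrite -[_ *: _]addr0; exact: DL. Qed.

Lemma domN v : D v -> D (- v).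
Proof. by rewrite -scaleN1r; exact: domZ. Qed.

Lemma sublinear_ge0 q v : sublinear_on q -> D v -> 0 <= q v + q (- v).
Proof.
move=> [qD qZ] Dv; have := qD v (- v) Dv (domN Dv); rewrite subrr.
have q00 : q 0 <= 0 by have := qZ 0 0 (lexx _) D0; rewrite scaler0 mul0r.
have := qD 0 0 D0 D0; rewrite addr0; lra.
Qed.

Lemma sublinearZ q a v :
  sublinear_on q -> 0 <= a -> D v -> q (a%:C *: v) = a * q v.
Proof.
move=> sq a0 Dv; have [qD qZ] := sq; apply/le_anti/andP; split; first exact: qZ.
move: a0; rewrite le0r => /orP[/eqP->|a0].
  rewrite mul0r scale0r; have := qD 0 0 D0 D0; rewrite addr0; lra.
have ai0 : 0 <= a^-1 by rewrite invr_ge0 ltW.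
have := qZ a^-1 (a%:C *: v) ai0 (domZ _ Dv).
rewrite scalerA -rmorphM mulVf ?gt_eqF// scale1r.
by rewrite -(ler_pM2l a0) mulrA mulfV ?gt_eqF// mul1r.
Qed.

(** The sublinear functionals built below are infima of sets of bounds: the directional gauge, the
    infimum of a chain and the seminorm given by a gauge. Bounds need to be additive and homogeneous
    only up to decreasing them. *)
Lemma inf_sublinear (B : V -> R -> Prop) :
  (forall v, D v -> exists c, B v c) ->
  (forall v, D v -> exists b, forall c, B v c -> b <= c) ->
  (forall v w c d, D v -> D w -> B v c -> B w d ->
     exists2 e, e <= c + d & B (v + w) e) ->
  (forall (a : R) v c, 0 <= a -> D v -> B v c ->
     exists2 e, e <= a * c & B (a%:C *: v) e) ->
  sublinear_on (fun v => inf [set c | B v c]).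
Proof.
move=> Bn Bb BD BZ.
have infle v c : D v -> B v c -> inf [set c | B v c] <= c.
  by move=> Dv Bvc; apply: ge_inf => //; have [b] := Bb v Dv; exists b.
have leinf v b : D v -> (forall c, B v c -> b <= c) -> b <= inf [set c | B v c].
  by move=> Dv h; apply: lb_le_inf => //; have [c] := Bn v Dv; exists c.
split.
- move=> v w Dv Dw; rewrite -lerBlDr; apply: (leinf) => // c Bc.
  rewrite lerBlDr [leRHS]addrC -lerBlDr; apply: (leinf) => // d Bd.
  have [e ecd Be] := BD _ _ _ _ Dv Dw Bc Bd.
  rewrite lerBlDr [leRHS]addrC; apply: le_trans ecd; exact: infle (domD Dv Dw) Be.
- move=> a v a0 Dv.
  move: (a0); rewrite le0r => /orP[/eqP a00|a1].
    have [c Bc] := Bn v Dv; have [e ec Be] := BZ _ _ _ a0 Dv Bc.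
    rewrite a00 !mul0r in ec Be *; apply: le_trans ec.
    by apply: (infle) => //; exact: domZ.
  rewrite -ler_pdivrMl //; apply: (leinf) => // c Bc.
  have [e ec Be] := BZ _ _ _ a0 Dv Bc.
  by rewrite ler_pdivrMl//; apply: le_trans ec; apply: infle Be; exact: domZ.
Qed.

(** The standard device for lowering a sublinear [q] in the direction [- v0]: the choice [t = 0]
    gives [dir_gauge q v0 v <= q v], and [t = 1] gives [dir_gauge q v0 (- v0) <= - q v0]. *)
Definition dir_gauge (q : V -> R) (v0 v : V) : R :=
  inf [set c | exists2 t : R, 0 <= t & c = q (v + t%:C *: v0) - t * q v0].

Lemma dir_gauge_lb q v0 v (t : R) : sublinear_on q -> D v0 -> D v -> 0 <= t ->
  - q (- v) <= q (v + t%:C *: v0) - t * q v0.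
Proof.
move=> sq Dv0 Dv t0; rewrite -(sublinearZ sq t0 Dv0).
have [qD _] := sq.
have := qD (v + t%:C *: v0) (- v) (domD Dv (domZ _ Dv0)) (domN Dv).
rewrite addrAC subrr add0r; lra.
Qed.

Lemma dir_gauge_le q v0 v (t : R) : sublinear_on q -> D v0 -> D v -> 0 <= t ->
  dir_gauge q v0 v <= q (v + t%:C *: v0) - t * q v0.
Proof.
move=> sq Dv0 Dv t0; apply: ge_inf; last by exists t.
by exists (- q (- v)) => _ [s s0 ->]; exact: dir_gauge_lb.
Qed.

Lemma dir_gauge_sublinear q v0 :
  sublinear_on q -> D v0 -> sublinear_on (dir_gauge q v0).
Proof.
move=> sq Dv0; have [qD qZ] := sq; apply: inf_sublinear.
- by move=> v Dv; exists (q (v + 0%:C *: v0) - 0 * q v0), 0.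
- by move=> v Dv; exists (- q (- v)) => _ [s s0 ->]; exact: dir_gauge_lb.
- move=> v w _ _ Dv Dw [t t0 ->] [s s0 ->].
  exists (q (v + w + (t + s)%:C *: v0) - (t + s) * q v0).
    have := qD _ _ (domD Dv (domZ t%:C Dv0)) (domD Dw (domZ s%:C Dv0)).
    rewrite addrACA -scalerDl -rmorphD; lra.
  by exists (t + s) => //; exact: addr_ge0.
- move=> a v _ a0 Dv [t t0 ->].
  exists (q (a%:C *: v + (a * t)%:C *: v0) - (a * t) * q v0).
    have := qZ _ _ a0 (domD Dv (domZ t%:C Dv0)).
    rewrite scalerDr scalerA -rmorphM; lra.
  by exists (a * t) => //; exact: mulr_ge0.
Qed.

(** Zorn's lemma. The infimum of a chain stays finite because every sublinear functional below [p]
    is at least [- p (- v)] at [v]. *)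
Lemma minimal_sublinear p : sublinear_on p -> exists q,
  [/\ sublinear_on q, (forall v, D v -> q v <= p v) &
      forall q', sublinear_on q' -> (forall v, D v -> q' v <= q v) ->
        forall v, D v -> q v <= q' v].
Proof.
move=> sp.
pose T := {q : V -> R | sublinear_on q /\ forall v, D v -> q v <= p v}.
pose mk q (qP : sublinear_on q /\ forall v, D v -> q v <= p v) : T := exist _ q qP.
(* The order is reversed, so that a maximal element is a minimal functional. *)
pose le (s t : T) := `[< forall v, D v -> sval t v <= sval s v >].
have pT : sublinear_on p /\ forall v, D v -> p v <= p v by [].
have [] := @ZL_preorder T (mk _ pT) le.
- by move=> t; apply/asboolP.
- move=> r s t /asboolP rs /asboolP st; apply/asboolP => v Dv.
  exact: le_trans (st _ Dv) (rs _ Dv).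
- move=> A totA.
  have [[s0 As0]|noA] := pselect (exists s, A s); last first.
    by exists (mk _ pT) => s As; exfalso; apply: noA; exists s.
  pose B v c := exists2 s, A s & c = sval s v.
  have lbB v c : D v -> B v c -> - p (- v) <= c.
    move=> Dv [s _ ->]; have [sq sp'] := svalP s.
    have := sublinear_ge0 sq Dv; have := sp' _ (domN Dv); lra.
  have sq : sublinear_on (fun v => inf [set c | B v c]).
    apply: inf_sublinear.
    - by move=> v Dv; exists (sval s0 v), s0.
    - by move=> v Dv; exists (- p (- v)) => c; exact: lbB.
    - move=> v w _ _ Dv Dw [s As ->] [t At ->].
      (* The smaller of two comparable members, taken at [v + w], lies below the sum of their
         separate values. *)
      have [/asboolP st|/asboolP st] := totA _ _ As At.
        exists (sval t (v + w)); last by exists t.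
        have [[qD _] _] := svalP t; apply: le_trans (qD _ _ Dv Dw) _.
        by rewrite lerD2r; exact: st.
      exists (sval s (v + w)); last by exists s.
      have [[qD _] _] := svalP s; apply: le_trans (qD _ _ Dv Dw) _.
      by rewrite lerD2l; exact: st.
    - move=> a v _ a0 Dv [s As ->]; exists (sval s (a%:C *: v)); last by exists s.
      by have [[_ qZ] _] := svalP s; exact: qZ.
  have infle v s : D v -> A s -> inf [set c | B v c] <= sval s v.
    move=> Dv As; apply: ge_inf; last by exists s.
    by exists (- p (- v)) => c; exact: lbB.
  have qT : sublinear_on (fun v => inf [set c | B v c]) /\
      forall v, D v -> inf [set c | B v c] <= p v.
    split=> // v Dv; apply: le_trans (infle v s0 Dv As0) _.
    by have [_] := svalP s0; exact.
  by exists (mk _ qT) => s As; apply/asboolP => v Dv /=; exact: infle.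
- move=> [q [sq qp]] qmax; exists q; split=> // q' sq' q'q.
  have q'T : sublinear_on q' /\ forall v, D v -> q' v <= p v.
    by split=> // v Dv; exact: le_trans (q'q _ Dv) (qp _ Dv).
  by have /asboolP := qmax (mk _ q'T) (asboolT q'q); exact.
Qed.

(* Passing from a minimal q to its directional gauge at v0 cannot lower q, which
   forces q (- v0) = - q v0: minimal sublinear functionals are linear. *)
Lemma Hahn_Banach_real p v0 : sublinear_on p -> D v0 -> exists f : V -> R,
  [/\ forall v w, D v -> D w -> f (v + w) = f v + f w,
      forall (a : R) v, D v -> f (a%:C *: v) = a * f v,
      forall v, D v -> f v <= p v & p v0 <= f v0].
Proof.
move=> sp Dv0.
have dirN q u : sublinear_on q -> D u -> dir_gauge q u (- u) <= - q u.
  move=> sq Du; have := dir_gauge_le sq Du (domN Du) ler01.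
  have q00 : q 0 <= 0 by have [_ qZ] := sq; have := qZ 0 0 (lexx _) D0; rewrite scaler0 mul0r.
  rewrite scale1r addNr; lra.
have dirle q u v : sublinear_on q -> D u -> D v -> dir_gauge q u v <= q v.
  move=> sq Du Dv; have := dir_gauge_le sq Du Dv (lexx 0).
  by rewrite scale0r addr0 mul0r subr0.
(* Minimizing below [dir_gauge p v0] rather than below [p] gives [f (- v0) <= - p v0], that is,
   [p v0 <= f v0]. *)
have [f [sf fp fmin]] := minimal_sublinear (dir_gauge_sublinear sp Dv0).
have [fD fZ] := sf.
have fN v : D v -> f (- v) = - f v.
  move=> Dv; have := sublinear_ge0 sf Dv.
  have := fmin _ (dir_gauge_sublinear sf Dv) (fun w Dw => dirle f v w sf Dv Dw) _ (domN Dv).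
  have := dirN _ _ sf Dv; lra.
exists f; split.
- move=> v w Dv Dw; apply/le_anti/andP; split; first exact: fD.
  have := fD _ _ (domN Dv) (domN Dw); rewrite -opprD !fN//; last exact: domD.
  lra.
- move=> a v Dv; have [a0|/ltW a0] := leP 0 a; first exact: sublinearZ.
  rewrite -[a in LHS]opprK rmorphN scaleNr fN; last exact: domZ.
  by rewrite sublinearZ // ?oppr_ge0// mulNr opprK.
- by move=> v Dv; apply: le_trans (fp _ Dv) _; exact: dirle.
- have := le_trans (fp _ (domN Dv0)) (dirN _ _ sp Dv0); rewrite fN //; lra.
Qed.

End Hahn_Banach_real.

Section Hahn_Banach_complex.
Local Open Scope complex_scope.
Context {R : realType} {V : lmodType R[i]}.

(* [B v c] is read "the seminorm of v is at most c"; the functional lives on the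
   subspace of the vectors that have some bound. *)
Lemma Hahn_Banach_gauge (B : V -> R -> Prop) (v0 : V) (c0 d : R) :
  (forall v c, B v c -> 0 <= c) ->
  (forall v w c e, B v c -> B w e -> B (v + w) (c + e)) ->
  (forall (a : R[i]) v c, B v c -> B (a *: v) (Re `|a| * c)) ->
  B v0 c0 -> (forall c, B v0 c -> d <= c) ->
  exists f : V -> R[i],
    [/\ forall (a : R[i]) v w, (exists c, B v c) -> (exists c, B w c) ->
          f (a *: v + w) = a * f v + f w,
        forall v c, B v c -> `|f v| <= c%:C & d%:C <= `|f v0|].
Proof.
move=> B0 BD BZ Bv0 dB.
pose D v := exists c, B v c.
have D0 : D 0 by exists (Re `|0 : R[i]| * c0); rewrite -(scale0r v0); exact: BZ.
have DL (a : R[i]) v w : D v -> D w -> D (a *: v + w).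
  by move=> [c Bc] [e Be]; exists (Re `|a| * c + e); apply: BD => //; exact: BZ.
pose p v := inf [set c | B v c].
have sp : sublinear_on D p.
  apply: (inf_sublinear D0 DL) => //.
  - by move=> v _; exists 0 => c; exact: B0.
  - by move=> v w c e _ _ Bc Be; exists (c + e) => //; exact: BD.
  - move=> a v c a0 _ Bc; exists (a * c) => //.
    by have := BZ a%:C _ _ Bc; rewrite ger0_norm// ler0c.
have pB v c : B v c -> p v <= c.
  by move=> Bc; apply: ge_inf => //; exists 0 => e; exact: B0.
have Dv0 : D v0 by exists c0.
have [g [gD gZ gp gv0]] := Hahn_Banach_real D0 DL sp Dv0.
(* The usual complexification: [g] becomes the real part of a complex-linear [f]. *)
pose f v : R[i] := g v +i* (- g ('i *: v)).
have DZ (a : R[i]) v : D v -> D (a *: v) by move=> Dv; exact: domZ.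
have fD v w : D v -> D w -> f (v + w) = f v + f w.
  move=> Dv Dw; rewrite /f scalerDr !gD//; try exact: DZ.
  by apply/eqP; rewrite eq_complex /= !eqxx /= opprD.
have fZ (a : R[i]) v : D v -> f (a *: v) = a * f v.
  move=> Dv; case: a => x y.
  have E (u : V) : D u -> g ((x +i* y) *: u) = x * g u + y * g ('i *: u).
    move=> Du; have Diu := DZ 'i u Du.
    rewrite -gZ // -gZ// -gD//; [|exact: DZ|exact: DZ].
    by rewrite scalerA -scalerDl; congr (g (_ *: _)); apply/eqP;
      rewrite eq_complex /=; apply/andP; split; apply/eqP; ring.
  have E1 := E v Dv; have E2 := E _ (DZ 'i v Dv).
  have E3 : 'i *: ((x +i* y) *: v) = (x +i* y) *: ('i *: v) by rewrite !scalerA mulrC.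
  rewrite /f E3 E1 E2.
  have -> : 'i *: ('i *: v) = (-1)%:C *: v.
    by rewrite scalerA; congr (_ *: _); apply/eqP; rewrite eq_complex /=;
      apply/andP; split; apply/eqP; ring.
  rewrite gZ//; apply/eqP; rewrite eq_complex /=.
  by apply/andP; split; apply/eqP; ring.
exists f; split.
- by move=> a v w Dv Dw; rewrite fD// ?fZ//; exact: DZ.
- move=> v c Bc; have Dv : D v by exists c.
  have [->|fv0] := eqVneq (f v) 0; first by rewrite normr0 ler0c; exact: B0 Bc.
  (* Rotating [v] makes the value of [f] real and nonnegative, so the real bound on [g] bounds the
     modulus of [f v]. *)
  pose a := `|f v| / f v.
  have a1 : `|a| = 1 by rewrite normrM normfV normr_id mulfV// normr_eq0.
  have fav : f (a *: v) = `|f v| by rewrite fZ// /a mulfVK.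
  have gav : g (a *: v) = Re `|f v| by rewrite -fav.
  have : Re `|f v| <= c.
    rewrite -gav; apply: le_trans (gp _ (DZ _ _ Dv)) _.
    by have := BZ a _ _ Bc; rewrite a1 mul1r; exact: pB.
  by rewrite -lecR RRe_real.
- have dp : d <= p v0 by apply: lb_le_inf; [exists c0 | move=> c; exact: dB].
  apply: le_trans (normc_ge_Re (f v0)); rewrite lecR.
  by apply: le_trans dp _; apply: le_trans gv0 _; exact: ler_norm.
Qed.

End Hahn_Banach_complex.

(** * Bounded functionals and biduals *)

Section Functionals.
Context {R : realType} {X : normedModType R[i]}.
Implicit Types (phi psi : X -> CC R) (z u : (X -> CC R) -> CC R) (x y : X).

(** The constant in [blf] is a complex number of no given sign; its product with the norm of [x] is
    nonnegative, so it may be replaced by its modulus. *)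
Lemma blf_bound phi : blf phi ->
  exists2 M : R[i], 0 <= M & forall x, `|phi x| <= M * `|x|.
Proof.
move=> [_ [M hM]]; exists `|M| => // x.
apply: le_trans (hM x) _.
have : 0 <= M * `|x| by exact: le_trans (hM x).
by move=> /ger0_norm <-; rewrite normrM normr_id.
Qed.

Lemma blfI phi (M : R[i]) :
  (forall (a : R[i]) x y, phi (a *: x + y) = a *: phi x + phi y) ->
  (forall x, `|phi x| <= M * `|x|) -> blf phi.
Proof. by move=> ? ?; split=> //; exists M. Qed.

Lemma blf0x phi : blf phi -> phi 0 = 0.
Proof. by move=> [h _]; have := h (-1) 0 0; rewrite scaler0 addr0 scaleN1r addNr. Qed.

Lemma blfZ phi (a : R[i]) x : blf phi -> phi (a *: x) = a *: phi x.
Proof. by move=> h; have := h.1 a x 0; rewrite (blf0x h) !addr0. Qed.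

Lemma blfD phi x y : blf phi -> phi (x + y) = phi x + phi y.
Proof. by move=> [h _]; have := h 1 x y; rewrite !scale1r. Qed.

Lemma blfB phi x y : blf phi -> phi (x - y) = phi x - phi y.
Proof. by move=> h; rewrite blfD// -scaleN1r blfZ// scaleN1r. Qed.

Lemma blf_lin phi psi (a : R[i]) :
  blf phi -> blf psi -> blf (fun x => a *: phi x + psi x).
Proof.
move=> hp hq; have [M M0 hM] := blf_bound hp; have [N N0 hN] := blf_bound hq.
apply: (@blfI _ (`|a| * M + N)).
- move=> b x y; rewrite hp.1 hq.1 !scalerDr !scalerA [a * b]mulrC.
  by rewrite -!addrA; congr (_ + _); rewrite addrCA.
- move=> x; apply: le_trans (ler_normD _ _) _; rewrite mulrDl normrM -mulrA.
  by apply: lerD => //; rewrite ler_wpM2l.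
Qed.

Lemma blf_cst0 : blf (fun _ : X => 0 : CC R).
Proof. by apply: (@blfI _ 0) => [a x y|x]; rewrite ?scaler0 ?addr0 ?normr0 ?mul0r. Qed.

Lemma blfZf (a : R[i]) phi : blf phi -> blf (fun x => a *: phi x).
Proof.
by move=> h; have := blf_lin a h blf_cst0; under eq_fun do rewrite addr0.
Qed.

Lemma blfDf phi psi : blf phi -> blf psi -> blf (fun x => phi x + psi x).
Proof.
by move=> h k; have := blf_lin 1 h k; under eq_fun do rewrite scale1r.
Qed.

Lemma bidual_bound z : bidual z -> exists2 M : R[i], 0 <= M &
  forall phi (N : R[i]), blf phi -> 0 <= N -> (forall x, `|phi x| <= N * `|x|) ->
    `|z phi| <= M * N.
Proof.
move=> [_ [M hM]]; exists `|M| => // phi N hp N0 hN.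
have h := hM phi N hp hN; have : 0 <= M * N by exact: le_trans h.
by move=> /ger0_norm E; apply: le_trans h _; rewrite -E normrM (ger0_norm N0).
Qed.

(* A nonzero vector is needed because [bidual] also quantifies over bounds [N]
   that are not nonnegative, which only exist on the zero space. *)
Lemma bidualI z (x0 : X) (M : R[i]) : x0 != 0 ->
  (forall (a : R[i]) phi psi, blf phi -> blf psi ->
     z (fun x => a *: phi x + psi x) = a *: z phi + z psi) ->
  (forall phi (N : R[i]), blf phi -> 0 <= N -> (forall x, `|phi x| <= N * `|x|) ->
    `|z phi| <= M * N) -> bidual z.
Proof.
move=> x00 zL hM; split=> //; exists M => phi N hp hN; apply: hM => //.
have := le_trans (normr_ge0 _) (hN x0).
by rewrite pmulr_lge0// normr_gt0.
Qed.

Lemma bidual0 z : bidual z -> z (fun=> 0) = 0.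
Proof.
move=> [h _]; have := h (-1) _ _ blf_cst0 blf_cst0.
by rewrite scaler0 addr0 => ->; rewrite scaleN1r addNr.
Qed.

Lemma bidualZ z (a : R[i]) phi : bidual z -> blf phi ->
  z (fun x => a *: phi x) = a *: z phi.
Proof.
move=> bz bp; have := bz.1 a _ _ bp blf_cst0; rewrite (bidual0 bz) addr0.
by under eq_fun do rewrite addr0.
Qed.

Lemma bidualD z phi psi : bidual z -> blf phi -> blf psi ->
  z (fun x => phi x + psi x) = z phi + z psi.
Proof.
move=> bz bp bq; have := bz.1 1 _ _ bp bq; rewrite scale1r.
by under eq_fun do rewrite scale1r.
Qed.

Lemma bidualB z phi psi : bidual z -> blf phi -> blf psi ->
  z (fun x => phi x - psi x) = z phi - z psi.
Proof.
move=> bz bp bq; rewrite -[- z psi]scaleN1r -bidualZ// -bidualD//; last exact: blfZf.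
by congr z; apply/funext => x; rewrite scaleN1r.
Qed.

End Functionals.

(** * First-order expansions with quadratic remainder *)

Section Differentiability.
Context {R : realType} {X : normedModType R[i]}.

(** A remainder bounded by [K] times the squared norm is little-o of [y], and [d] is continuous, so
    [d] is the differential. Affine maps are the case [K = 0]. *)
Lemma quadratic_remainder_diff (f d : X -> CC R) (x : X) (K : R[i]) :
  blf d -> (forall y, `|f (x + y) - f x - d y| <= K * `|y| * `|y|) ->
  differentiable f x /\ forall v, derive f x v = d v.
Proof.
move=> bd fK.
have ld : linear d by move=> a y y'; rewrite bd.1.
pose dL : {linear X -> CC R} := HB.pack d (GRing.isLinear.Build _ _ _ _ d ld).
have cd : continuous dL.
  apply/linear_bounded_continuous/linear_boundedP.
  have [M M0 hM] := blf_bound bd; exists M; split; first exact: ger0_real.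
  move=> r Mr y; apply: le_trans (hM y) _; rewrite ler_wpM2r//; exact: ltW.
have ed : f \o shift x = cst (f x) + (dL : X -> CC R) +o_ (0 : X) id.
  apply/eqaddoP => e e0; near=> y.
  rewrite [X in `|X|](_ : _ = f (x + y) - f x - d y); last first.
    by rewrite !fctE /= opprD addrA [y + x]addrC.
  apply: le_trans (fK y) _; rewrite ler_wpM2r//.
  (* The radius divides by the modulus of [K] plus 1, which is positive whatever [K] is. *)
  near: y; have K1 : 0 < `|K| + 1 by rewrite ltr_wpDl.
  apply/nbhs_norm0P; exists (e / (`|K| + 1)); first by rewrite /= divr_gt0.
  move=> y /= ye.
  have [->|y0] := eqVneq y 0; first by rewrite normr0 mulr0 ltW.
  have yp : 0 < `|y| by rewrite normr_gt0.
  have Ky : 0 <= K * `|y| * `|y| by exact: le_trans (fK y).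
  rewrite pmulr_lge0// in Ky; rewrite -(ger0_norm Ky) normrM normr_id.
  apply: le_trans (_ : (`|K| + 1) * `|y| <= _); first by rewrite ler_wpM2r// lerDl.
  by rewrite mulrC -ler_pdivlMr// ltW.
have dE : 'd f x = dL :> (X -> CC R) by exact: diff_unique.
have df : differentiable f x.
  by apply/diff_locallyP; rewrite dE; split => //; exact: cd.
by split=> // v; rewrite deriveE// dE.
Unshelve. all: by end_near. Qed.

End Differentiability.

(** * Quadratic polynomials *)

Section Quadratic.
Context {R : realType} {X : normedModType R[i]}.
Implicit Types (l : X -> CC R) (z u : (X -> CC R) -> CC R) (x y : X).

Definition bounded_symmetric_bilinear (B : X -> X -> CC R) : Prop :=
  [/\ forall x y, B x y = B y x,
      forall (a : R[i]) x y y', B x (a *: y + y') = a *: B x y + B x y' &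
      exists2 K : R[i], 0 <= K & forall x y, `|B x y| <= K * `|x| * `|y|].

Lemma derive_cst_fun (c : CC R) (v x : X) : derive (fun=> c) x v = 0.
Proof.
have [|_ ->//] := @quadratic_remainder_diff R X (fun=> c) (fun=> 0) x 0 blf_cst0.
by move=> y; rewrite subrr subr0 normr0 !mul0r.
Qed.

Lemma derive_affine l (c : CC R) (v x : X) :
  blf l -> derive (fun y => l y + c) x v = l v.
Proof.
move=> bl; have [|_ ->//] := @quadratic_remainder_diff R X (fun y => l y + c) l x 0 bl.
move=> y; rewrite !mul0r blfD// (_ : _ - _ = 0) ?normr0//; ring.
Qed.

Variable B : X -> X -> CC R.
Hypothesis bB : bounded_symmetric_bilinear B.

Let symB x y : B x y = B y x. Proof. by case: bB. Qed.

Lemma blf_bilinear x : blf (B x).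
Proof.
have [_ LB [K K0 hK]] := bB; apply: (@blfI _ _ _ (K * `|x|)) => [a y y'|y] //.
Qed.

Lemma blf_bilinear_l y : blf (B ^~ y).
Proof. by rewrite (_ : B ^~ y = B y); [exact: blf_bilinear|apply/funext => x]. Qed.

(** Makes the second step of the iterated extension legitimate: after [u] has acted on one variable,
    the other still enters through a bounded functional. *)
Lemma blf_bidual_bilinear u : bidual u -> blf (fun x => u (B x)).
Proof.
move=> bu; have [_ LB [K K0 hK]] := bB; have [M M0 hM] := bidual_bound bu.
apply: (@blfI _ _ _ (M * K)) => [a x y|x].
  rewrite -bu.1; [|exact: blf_bilinear|exact: blf_bilinear].
  by congr u; apply/funext => w; rewrite symB LB !(symB w).
by rewrite -mulrA; apply: hM; [exact: blf_bilinear | exact: mulr_ge0 | exact: hK].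
Qed.

(** The affine part is carried along because translating [B y y] by [x] produces the terms
    [2 *: B x y] and [B x x]. *)
Definition quadratic l (c : CC R) : X -> CC R := fun y => B y y + l y + c.

Lemma quadratic_diff l (c : CC R) x : blf l ->
  differentiable (quadratic l c) x /\
  forall v, derive (quadratic l c) x v = 2 *: B v x + l v.
Proof.
move=> bl; have [_ LB [K K0 hK]] := bB.
have bB2 : blf (fun v => (2 : R[i]) *: B v x + l v).
  by apply: blf_lin => //; exact: blf_bilinear_l.
apply: (@quadratic_remainder_diff _ _ _ _ _ K bB2) => y.
rewrite (_ : _ - _ = B y y); first exact: hK.
rewrite /quadratic [B (x + y) _]symB (blfD x y (blf_bilinear_l _)).
rewrite !(blfD x y (blf_bilinear _)) (blfD x y bl) (symB x y).
rewrite -[2 *: _]/(2 * _); ring.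
Qed.

Lemma Hb_quadratic l (c : CC R) : blf l -> Hb (quadratic l c).
Proof.
move=> bl; split=> [x|r]; first by have [] := quadratic_diff c x bl.
have [_ LB [K K0 hK]] := bB; have [M M0 hM] := blf_bound bl.
exists (K * r * r + M * r + `|c|) => x xr.
apply: le_trans (ler_normD _ _) _; rewrite lerD2r.
apply: le_trans (ler_normD _ _) _; apply: lerD.
  apply: le_trans (hK x x) _; apply: ler_pM => //; first exact: mulr_ge0.
  by rewrite ler_wpM2l.
by apply: le_trans (hM x) _; rewrite ler_wpM2l.
Qed.

(** [iterD] differentiates along the last vector of the list first, so lists are peeled from the
    right, each peeling lowering the degree by one. *)
Lemma iterD_rcons (f g : X -> CC R) (s : seq X) (w : X) :
  (forall a, derive f a w = g a) -> iterD f (rcons s w) = iterD g s.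
Proof.
by move=> fg; rewrite /Defs.iterD foldr_rcons; congr foldr; exact/funext.
Qed.

Lemma iterD_quadratic_rcons l (c : CC R) s y : blf l ->
  iterD (quadratic l c) (rcons s y) = iterD (fun a => 2 *: B y a + l y) s.
Proof.
by move=> bl; apply: iterD_rcons => a; rewrite (quadratic_diff c a bl).2 symB.
Qed.

Let blf_2B y : blf (fun a => (2 : R[i]) *: B y a).
Proof. by apply: blfZf; exact: blf_bilinear. Qed.

Lemma iterD_quadratic2 l (c : CC R) x y :
  blf l -> iterD (quadratic l c) [:: x; y] 0 = 2 *: B x y.
Proof.
move=> bl; rewrite (iterD_quadratic_rcons c [:: x] y bl).
by rewrite -[LHS]/(derive (fun a => 2 *: B y a + l y) 0 x) derive_affine ?(symB y).
Qed.

Lemma iterD_cst0 s x : iterD (fun=> 0) s x = 0 :> CC R.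
Proof.
elim/last_ind: s => // s t IH.
by rewrite (@iterD_rcons _ (fun=> 0)) // => a; exact: derive_cst_fun.
Qed.

Lemma iterD_quadratic3 l (c : CC R) (s : seq X) x :
  blf l -> (2 < size s)%N -> iterD (quadratic l c) s x = 0.
Proof.
move=> bl; elim/last_ind: s => // s y _.
elim/last_ind: s => // s w _.
elim/last_ind: s => // s v _ _.
rewrite iterD_quadratic_rcons//.
rewrite (@iterD_rcons _ (fun=> 2 *: B y w)); last by move=> a; exact: derive_affine.
rewrite (@iterD_rcons _ (fun=> 0)); last by move=> a; exact: derive_cst_fun.
exact: iterD_cst0.
Qed.

Lemma AB_nseq0 z (n : nat) (A : seq X -> CC R) : bidual z ->
  (forall s, size s = n -> A s = 0) -> AB (nseq n z) A = 0.
Proof.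
move=> bz; elim: n A => [|n IH] A hA /=; first exact: hA.
rewrite -[RHS](bidual0 bz); congr z; apply/funext => x.
by apply: IH => s ss; apply: hA; rewrite /= ss.
Qed.

(** The Taylor series stops at degree 2, where the factor 2 of the second derivative cancels
    [1/2!]. *)
Lemma tdelta_quadratic z l (c : CC R) : bidual z -> blf l ->
  tdelta z (quadratic l c) = c + z l + z (fun x => z (B x)).
Proof.
move=> bz bl; rewrite /tdelta /AB_ext; set a := (X in series X).
have a0 : a 0%N = c.
  rewrite /a /= fact0 invr1 scale1r /quadratic (blf0x bl) (blf0x (blf_bilinear 0)).
  by rewrite !add0r.
have a1 : a 1%N = z l.
  rewrite /a /= invr1 scale1r; congr z; apply/funext => x.
  by rewrite (quadratic_diff c 0 bl).2 (blf0x (blf_bilinear x)) scaler0 add0r.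
have a2 : a 2%N = z (fun x => z (B x)).
  rewrite /a -[AB _ _]/(z (fun x => z (fun y => iterD (quadratic l c) [:: x; y] 0))).
  under eq_fun => x.
    under eq_fun do rewrite iterD_quadratic2//.
    rewrite bidualZ//; last exact: blf_bilinear.
    over.
  rewrite bidualZ//; last exact: blf_bidual_bilinear.
  by rewrite scalerA mulVf ?scale1r// pnatr_eq0.
have a3 m : (2 < m)%N -> a m = 0.
  move=> m2; rewrite /a AB_nseq0 ?scaler0// => s ss.
  by rewrite iterD_quadratic3// ss.
apply: cvg_lim => //; apply: cvg_near_cst; exists 3%N => // n /= n3.
have T : \sum_(3 <= i < n) a i = 0.
  by rewrite big_nat big1// => i /andP[i3 _]; exact: a3.
rewrite /series /= (@big_cat_nat _ _ _ 3)//= T addr0.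
by rewrite !big_nat_recr//= big_geq// add0r a0 a1 a2.
Qed.

(** Applying [u] to the translate by [x] gives again a quadratic polynomial in [x], with linear part
    [2 *: u (B x)]. In the result only the mixed term depends on the order of [z] and [u]. *)
Lemma convolution_quadratic z u : bidual z -> bidual u ->
  convolution (tdelta z) (tdelta u) (fun x => B x x) =
  u (fun x => u (B x)) + 2 *: z (fun x => u (B x)) + z (fun x => z (B x)).
Proof.
move=> bz bu; rewrite /convolution.
have bub := blf_bidual_bilinear bu.
have -> : (fun x => tdelta u (transl x (fun y => B y y))) =
    quadratic (fun x => 2 *: u (B x)) (u (fun x => u (B x))).
  apply/funext => x.
  have -> : transl x (fun y => B y y) = quadratic (fun y => 2 *: B x y) (B x x).
    apply/funext => y; rewrite /transl /quadratic.
    rewrite (blfD y x (blf_bilinear_l _)) !(blfD y x (blf_bilinear _)) (symB y x).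
    rewrite -[2 *: _]/(2 * _); ring.
  by rewrite tdelta_quadratic// bidualZ//; exact: blf_bilinear.
rewrite tdelta_quadratic//; last exact: blfZf.
by rewrite bidualZ.
Qed.

(** Both convolutions contain the same pure terms in [u] and in [z]; cancelling them and the factor
    2 leaves the mixed terms. *)
Lemma commuting_iterated_bilinear z u : bidual z -> bidual u ->
  (forall f : X -> CC R, Hb f ->
     convolution (tdelta z) (tdelta u) f = convolution (tdelta u) (tdelta z) f) ->
  z (fun x => u (B x)) = u (fun x => z (B x)).
Proof.
move=> bz bu /(_ (fun x => B x x)).
have -> : (fun x => B x x) = quadratic (fun=> 0) 0.
  by apply/funext => x; rewrite /quadratic !addr0.
move/(_ (Hb_quadratic 0 blf_cst0)).
have <- : (fun x => B x x) = quadratic (fun=> 0) 0.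
  by apply/funext => x; rewrite /quadratic !addr0.
rewrite !convolution_quadratic// addrAC [RHS]addrAC [u _ + z _]addrC.
by move/addrI/scalerI; apply; rewrite pnatr_eq0.
Qed.

End Quadratic.

(** * Norming functionals and closedness of the canonical image *)

Section Bidual.
Local Open Scope complex_scope.
Context {R : realType}.

Lemma ge0_Re (c : R[i]) : 0 <= c -> (Re c)%:C = c.
Proof. by move=> c0; rewrite RRe_real// ger0_real. Qed.

Lemma realcM (a b : R) : (a * b)%:C = a%:C * b%:C :> R[i].
Proof. exact: rmorphM. Qed.

Lemma realcD (a b : R) : (a + b)%:C = a%:C + b%:C :> R[i].
Proof. exact: rmorphD. Qed.

(** Hahn-Banach for the norm itself, [B y c] meaning that the norm of [y] is at most [c]. *)
Lemma norming_functional (X : normedModType R[i]) (x : X) :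
  exists phi : X -> CC R,
    [/\ blf phi, forall y, `|phi y| <= `|y| & `|x| <= `|phi x|].
Proof.
have ReN (y : X) : (Re `|y|)%:C = `|y| by exact: ge0_Re.
pose B (y : X) (c : R) : Prop := `|y| <= c%:C.
have B0 v c : B v c -> 0 <= c by rewrite -ler0c; exact: le_trans.
have BD v w c e : B v c -> B w e -> B (v + w) (c + e).
  move=> vc we; rewrite /B realcD; apply: le_trans (ler_normD _ _) _.
  exact: lerD.
have BZ (a : R[i]) v c : B v c -> B (a *: v) (Re `|a| * c).
  by move=> vc; rewrite /B normrZ realcM ge0_Re// ler_wpM2l.
have Bx : B x (Re `|x|) by rewrite /B ReN.
have [|f [fL fle fx]] := Hahn_Banach_gauge B0 BD BZ Bx (d := Re `|x|).
  by move=> c; rewrite /B -lecR ReN.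
exists f; split; last by rewrite -ReN.
  apply: (@blfI _ _ _ 1) => [a v w|v].
    by apply: fL; [exists (Re `|v|)|exists (Re `|w|)]; rewrite /B ReN.
  by rewrite mul1r -[`|v|]ReN; apply: fle; rewrite /B ReN.
by move=> v; rewrite -[`|v|]ReN; apply: fle; rewrite /B ReN.
Qed.

Lemma invS_small (e : R) : 0 < e -> exists N, forall n, (N <= n)%N -> n.+1%:R^-1 < e.
Proof.
move=> e0; have [N] := @ltr_add_invr R 0 e e0; rewrite add0r => Ne.
exists N => n Nn; apply: le_lt_trans Ne.
by rewrite lef_pV2 ?posrE// ler_nat.
Qed.

(** Approximants [a n] within [1/(n+1)] of [z] form a Cauchy sequence, as seen by norming their
    differences, and [z] is evaluation at the limit. *)
Lemma canonical_image_closed (F : completeNormedModType R[i])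
    (z : (F -> CC R) -> CC R) : bidual z ->
  (forall e : R, 0 < e -> exists a : F, forall (phi : F -> CC R) (N : R[i]),
     blf phi -> 0 <= N -> (forall y, `|phi y| <= N * `|y|) ->
     `|z phi - phi a| <= e%:C * N) ->
  in_canonical_image z.
Proof.
move=> bz happ.
have /choice[a ha] (n : nat) := happ n.+1%:R^-1 ltac:(by rewrite invr_gt0).
have aa n m : `|a n - a m| <= (n.+1%:R^-1 + m.+1%:R^-1)%:C.
  have [psi [bpsi psi1 psia]] := norming_functional (a n - a m).
  have psi1' y : `|psi y| <= 1 * `|y| by rewrite mul1r.
  apply: le_trans psia _; rewrite blfB//.
  rewrite (_ : _ - _ = (z psi - psi (a m)) - (z psi - psi (a n))); last by ring.
  apply: le_trans (ler_normB _ _) _; rewrite [leLHS]addrC realcD.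
  by apply: lerD; rewrite -[leRHS]mulr1; exact: ha.
have cva : cvgn a.
  apply/cauchy_cvgP/cauchy_exP => e e0.
  have eE : (Re e)%:C = e by apply: ge0_Re; exact: ltW.
  have e2 : 0 < Re e / 2 by rewrite divr_gt0// -ltcR eE.
  have [N hN] := invS_small e2.
  exists (a N); exists N => // n /= Nn; rewrite -ball_normE /=.
  apply: le_lt_trans (aa N n) _; rewrite -[ltRHS]eE ltcR [ltRHS]splitr.
  by apply: ltrD; apply: hN.
exists (limn a) => phi bphi.
have [M M0 hM] := blf_bound bphi.
apply/eqP; rewrite -subr_eq0 -normr_le0.
apply/ler_addgt0Pr => e e0; rewrite add0r.
have M1 : 0 < M + 1 by rewrite ltr_wpDl.
(* Each of the two errors below is at most [M] times this tolerance, hence at most [e / 2]; the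
   added 1 allows [M = 0]. *)
have eE : (Re (e / 2 / (M + 1)))%:C = e / 2 / (M + 1).
  by apply: ge0_Re; rewrite !divr_ge0 ?ltW.
have e2 : 0 < Re (e / 2 / (M + 1)) by rewrite -ltcR eE !divr_gt0.
have eM : (e / 2 / (M + 1)) * M <= e / 2.
  rewrite -[leRHS]mulr1 -mulrA ler_wpM2l//; first by rewrite divr_ge0// ltW.
  by rewrite ler_pdivrMl// mulr1 lerDl.
have [N hN] := invS_small e2.
have /cvgrPdist_lt /(_ (e / 2 / (M + 1))) := cva.
rewrite !divr_gt0// => /(_ isT)[N' _ hN'].
pose n := maxn N N'.
rewrite (_ : _ - _ = (z phi - phi (a n)) + (phi (a n) - phi (limn a))); last by ring.
apply: le_trans (ler_normD _ _) _; rewrite [leRHS]splitr; apply: lerD.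
  apply: le_trans (ha n phi M bphi M0 hM) _.
  apply: le_trans (_ : (e / 2 / (M + 1)) * M <= _).
    by rewrite ler_wpM2r// -eE lecR ltW// hN// leq_maxl.
  exact: eM.
rewrite -blfB//; apply: le_trans (hM _) _.
apply: le_trans (_ : M * (e / 2 / (M + 1)) <= _).
  rewrite ler_wpM2l// distrC ltW//; apply: hN' => /=; exact: leq_maxr.
by rewrite mulrC; exact: eM.
Qed.

End Bidual.

(** * The case F (+) F' *)

Section Commuting.
Local Open Scope complex_scope.
Context {R : realType} {X : normedModType R[i]}.

Definition commuting (z : (X -> CC R) -> CC R) : Prop :=
  forall u, bidual u -> forall f, Hb f ->
    convolution (tdelta z) (tdelta u) f = convolution (tdelta u) (tdelta z) f.

Lemma commuting_bilinear z u B : bidual z -> commuting z -> bidual u ->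
  bounded_symmetric_bilinear B -> z (fun x => u (B x)) = u (fun x => z (B x)).
Proof. by move=> bz cz bu bB; exact: commuting_iterated_bilinear (cz u bu). Qed.

End Commuting.

(** * Functionals annihilating the canonical image *)

Section Canonical_distance.
Local Open Scope complex_scope.
Context {R : realType} {F : normedModType R[i]}.

Let RR (c : R[i]) (c0 : 0 <= c) : (Re c)%:C = c := ge0_Re c0.

(** Norm distance at most [c] between [zeta] and the canonical image of [a], tested on each bounded
    functional. Here [zeta] ranges over all functions, so that their pointwise vector space
    structure is available. *)
Definition near_canonical (zeta : (F -> CC R) -> CC R) (a : F) (c : R) : Prop :=
  0 <= c /\ forall (phi : F -> CC R) (N : R[i]), blf phi -> 0 <= N ->
    (forall y, `|phi y| <= N * `|y|) -> `|zeta phi - phi a| <= c%:C * N.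

(** Hahn-Banach for the distance to the canonical image, a seminorm that is 0 on the image and at
    least [e] at [z]. *)
Lemma annihilator_of_canonical (z : (F -> CC R) -> CC R) (e : R) :
  0 < e -> bidual z -> (forall a, ~ near_canonical z a e) ->
  exists U : ((F -> CC R) -> CC R) -> R[i],
    [/\ forall (a : R[i]) v w, (exists b c, near_canonical v b c) ->
           (exists b c, near_canonical w b c) -> U (a *: v + w) = a * U v + U w,
        forall v a c, near_canonical v a c -> `|U v| <= c%:C & U z != 0].
Proof.
move=> e0 bz zfar.
pose B (v : (F -> CC R) -> CC R) (c : R) := exists a, near_canonical v a c.
have B0 v c : B v c -> 0 <= c by case=> a [].
have BD v w c d : B v c -> B w d -> B (v + w) (c + d).
  move=> [a [c0 ha]] [b [d0 hb]]; exists (a + b); split=> [|phi N bp N0 hN].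
    exact: addr_ge0.
  rewrite (_ : _ - _ = (v phi - phi a) + (w phi - phi b)); last first.
    by rewrite blfD// !fctE /=; ring.
  apply: le_trans (ler_normD _ _) _; rewrite realcD mulrDl.
  by apply: lerD; [exact: ha|exact: hb].
have BZ (a : R[i]) v c : B v c -> B (a *: v) (Re `|a| * c).
  move=> [b [c0 hb]]; exists (a *: b); split=> [|phi N bp N0 hN].
    by rewrite mulr_ge0// -ler0c RR.
  rewrite (_ : _ - _ = a *: (v phi - phi b)); last first.
    by rewrite blfZ// scalerBr.
  by rewrite normrM realcM RR// -mulrA ler_wpM2l//; exact: hb.
have [M M0 hM] := bidual_bound bz.
have Bz : B z (Re M).
  exists 0; split=> [|phi N bp N0 hN]; first by rewrite -ler0c RR.
  by rewrite (blf0x bp) subr0 RR//; exact: hM.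
have [|U [UL Ule Uz]] := Hahn_Banach_gauge B0 BD BZ Bz (d := e).
  move=> c [a [c0 ha]]; rewrite leNgt; apply/negP => ce; apply: (zfar a).
  split=> [|phi N bp N0 hN]; first exact: ltW.
  apply: le_trans (ha _ _ bp N0 hN) _; rewrite ler_wpM2r// lecR; exact: ltW.
exists U; split.
- by move=> a v w [b [c bc]] [b' [c' bc']]; apply: UL; [exists c, b|exists c', b'].
- by move=> v a c h; apply: Ule; exists a.
- by rewrite -normr_gt0; apply: lt_le_trans Uz; rewrite ltcR.
Qed.

End Canonical_distance.

Section Sum_with_dual.
Local Open Scope complex_scope.
Context {R : realType} {X : normedModType R[i]} {F : completeNormedModType R[i]}.

(** On the zero space every bidual element is evaluation at 0. The nonzero vector feeds [bidualI]
    and the positivity of operator norms. *)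
Lemma non_reflexive_nontrivial : @non_reflexive R F -> exists y : F, y != 0.
Proof.
move=> [z [bz nz]]; apply: contrapT => F0; apply: nz.
have Fy (y : F) : y = 0.
  by apply: contrapT => y0; apply: F0; exists y; exact/eqP.
exists 0 => phi bp; rewrite (blf0x bp) -(bidual0 bz); congr z; apply/funext => y.
by rewrite (Fy y) (blf0x bp).
Qed.

Lemma sum_with_dual_commuting (z : (X -> CC R) -> CC R) :
  @non_reflexive R F -> is_sum_with_dual X F -> bidual z -> commuting z ->
  in_canonical_image z.
Proof.
move=> /non_reflexive_nontrivial[y0 y00] [T [TL [TN TS]]] bz cz.
have fstL (a : R[i]) x y : (T (a *: x + y)).1 = a *: (T x).1 + (T y).1 by rewrite TL.
have sndL (a : R[i]) x y w : (T (a *: x + y)).2 w = a *: (T x).2 w + (T y).2 w by rewrite TL.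
have bsnd x : blf (T x).2 := (TN x).1.
have opn_ge0 (phi : F -> CC R) N : is_opnorm phi N -> 0 <= N.
  move=> [h _]; have := le_trans (normr_ge0 _) (h y0).
  by rewrite pmulr_lge0// normr_gt0.
(* The sum norm is encoded through the operator norm of the second component, which is what remains
   after removing the norm of the first; its nonnegativity gives this bound. *)
have fst_le x : `|(T x).1| <= `|x| by rewrite -subr_ge0; exact: opn_ge0 (TN x).2.
have snd_le x w : `|(T x).2 w| <= `|x| * `|w|.
  by apply: le_trans ((TN x).2.1 w) _; rewrite ler_wpM2r// gerBl.
have Tinj x y : (T x).1 = (T y).1 -> (forall w, (T x).2 w = (T y).2 w) -> x = y.
  move=> e1 e2; apply/esym/eqP; rewrite -subr_eq0 -normr_le0.
  have d1 : (T (y - x)).1 = 0 by rewrite -scaleN1r addrC fstL e1 scaleN1r addNr.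
  have d2 w : (T (y - x)).2 w = 0.
    by rewrite -scaleN1r addrC sndL e2 scaleN1r addNr.
  have [_ /(_ 0)] := (TN (y - x)).2; rewrite d1 normr0 subr0; apply => w.
  by rewrite d2 normr0 mul0r.
(* [i1] and [i2] are the injections of the two summands; off the bounded functionals [i2] takes
   arbitrary values. *)
have /choice[i1 Ti1] (a : F) := TS a _ blf_cst0.
have /choice[i2 Ti2] (phi : F -> CC R) : exists x, blf phi -> T x = (0, phi).
  have [bp|nbp] := pselect (blf phi); last by exists 0.
  by have [x ?] := TS 0 _ bp; exists x.
have i1L (a : R[i]) x y : i1 (a *: x + y) = a *: i1 x + i1 y.
  by apply: Tinj => [|w]; rewrite ?fstL ?sndL !Ti1//= scaler0 addr0.
have i2L (a : R[i]) phi psi : blf phi -> blf psi ->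
    i2 (fun w => a *: phi w + psi w) = a *: i2 phi + i2 psi.
  move=> bp bq; have bpq := blf_lin a bp bq.
  by apply: Tinj => [|w]; rewrite ?fstL ?sndL !Ti2//= scaler0 addr0.
have i1_le a : `|i1 a| <= `|a|.
  have [_ /(_ 0)] := (TN (i1 a)).2; rewrite Ti1 /= subr_le0; apply => w.
  by rewrite normr0 mul0r.
have i2_le phi N : blf phi -> (forall w, `|phi w| <= N * `|w|) -> `|i2 phi| <= N.
  move=> bp hN; have [_ /(_ N)] := (TN (i2 phi)).2.
  by rewrite Ti2//= normr0 subr0; apply.
have i1i2 x : i1 (T x).1 + i2 (T x).2 = x.
  apply: Tinj => [|w]; rewrite -[i1 _]scale1r ?fstL ?sndL Ti1 Ti2//= scale1r ?addr0//.
  by rewrite add0r.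
have x00 : i1 y0 != 0.
  apply/eqP => y0E; move/eqP: y00; apply; have := fst_le (i1 y0).
  by rewrite Ti1 /= y0E normr0 normr_le0 => /eqP.
pose B x y : CC R := (T x).2 (T y).1 + (T y).2 (T x).1.
have bB : bounded_symmetric_bilinear B.
  split=> [x y|a x y y'|]; first by rewrite /B addrC.
    by rewrite /B fstL sndL (bsnd x).1 scalerDr addrACA.
  exists 2 => // x y; apply: le_trans (ler_normD _ _) _.
  rewrite -mulrA mulrDl mul1r; apply: lerD.
    by apply: le_trans (snd_le _ _) _; rewrite ler_wpM2l.
  by rewrite mulrC; apply: le_trans (snd_le _ _) _; rewrite ler_wpM2l.
have bB0 x := blf_bilinear bB x.
have B1 x b : B x (i1 b) = (T x).2 b by rewrite /B Ti1 /= addr0.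
have B2 x phi : blf phi -> B x (i2 phi) = phi (T x).1.
  by move=> bp; rewrite /B Ti2//= (blf0x (bsnd x)) add0r.
have symB x y : B x y = B y x by case: bB.
have bfst phi : blf phi -> blf (fun x => phi (T x).1).
  move=> bp; have [M M0 hM] := blf_bound bp.
  apply: (@blfI _ _ _ M) => [a x y|x]; first by rewrite fstL bp.1.
  by apply: le_trans (hM _) _; rewrite ler_wpM2l.
have [M M0 hM] := bidual_bound bz.
pose z1 phi := z (fun x => phi (T x).1).
have bz1 : bidual z1.
  apply: (@bidualI _ _ z1 y0 M y00) => [a phi psi bp bq|phi N bp N0 hN].
    by rewrite /z1 -bz.1//; exact: bfst.
  apply: hM => //; first exact: bfst.
  by move=> x; apply: le_trans (hN _) _; rewrite ler_wpM2l.
have ReE (c : R[i]) : 0 <= c -> (Re c)%:C = c by exact: ge0_Re.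
have [a za] : in_canonical_image z1.
  apply: canonical_image_closed => // e e0; apply: contrapT => zfar.
  have {}zfar a : ~ near_canonical z1 a e.
    by move=> [_ ha]; apply: zfar; exists a.
  have [U [UL Ule Uz]] := annihilator_of_canonical e0 bz1 zfar.
  (* The element (0, U) of X'': restricting [chi] to the summand F' gives an element of F''. *)
  pose u chi := U (fun phi => chi (i2 phi)).
  have dual_near chi N : blf chi -> 0 <= N -> (forall x, `|chi x| <= N * `|x|) ->
      near_canonical (fun phi => chi (i2 phi)) 0 (Re N).
    move=> bc N0 hN; split=> [|phi N' bp N'0 hN']; first by rewrite -ler0c ReE.
    rewrite (blf0x bp) subr0 ReE//; apply: le_trans (hN _) _.
    by rewrite ler_wpM2l// i2_le.
  have bu : bidual u.
    apply: (@bidualI _ _ u _ 1 x00) => [c phi psi bp bq|phi N bp N0 hN].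
      have [Mp Mp0 hMp] := blf_bound bp; have [Mq Mq0 hMq] := blf_bound bq.
      rewrite /u -[RHS]UL//.
        by exists 0, (Re Mp); exact: dual_near.
      by exists 0, (Re Mq); exact: dual_near.
    rewrite mul1r -[leRHS]ReE//; apply: Ule; exact: dual_near.
  (* On F' the functional [B x] is evaluation at [(T x).1], a canonical element, hence killed by
     [U]. *)
  have uB x : u (B x) = 0.
    apply/eqP; rewrite -normr_le0; apply: (Ule _ (T x).1); split=> // phi N bp _ _.
    by rewrite B2// subrr normr0 mul0r.
  have := commuting_bilinear bz cz bu bB; under eq_fun do rewrite uB.
  rewrite (bidual0 bz) => /esym.
  (* Commutation says that [U] vanishes at [phi |-> z (B (i2 phi))]. This function agrees with [z1]
     only on bounded functionals, so the two are compared through their distance 0; then [U z1 = 0],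
     a contradiction. *)
  have same : near_canonical (((fun phi => z (B (i2 phi))) : (F -> CC R) -> CC R) - z1) 0 0.
    split=> // phi N bp N0 hN; rewrite (_ : _ - _ = 0) ?normr0 ?mul0r//.
    rewrite (blf0x bp) subr0 !fctE /z1; apply/eqP; rewrite subr_eq0; apply/eqP.
    by congr z; apply/funext => x; rewrite symB B2.
  have [M1 M10 hM1] := bidual_bound bz1.
  have Dz1 : near_canonical z1 0 (Re M1).
    split=> [|phi N bp N0 hN]; first by rewrite -ler0c ReE.
    by rewrite (blf0x bp) subr0 ReE//; exact: hM1.
  rewrite /u -[X in U X](subrK z1) -[_ - z1]scale1r UL; last 2 first.
  - by exists 0, 0.
  - by exists 0, (Re M1).
  have /eqP -> : U ((fun phi => z (B (i2 phi))) - z1) == 0.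
    by rewrite -normr_le0; exact: Ule same.
  by rewrite mulr0 add0r => /eqP; exact/negP.
(* [phi0] is z2 o J, an element of F'. *)
pose phi0 b := z (fun y => (T y).2 b).
have bev b : blf (fun y => (T y).2 b).
  by apply: (@blfI _ _ _ `|b|) => [c x y|x]; rewrite ?sndL// mulrC.
have bphi0 : blf phi0.
  apply: (@blfI _ _ _ M) => [c b b'|b].
    rewrite /phi0 -bz.1//; congr z; apply/funext => y; exact: (bsnd y).1.
  by apply: hM => // x; rewrite mulrC.
have z2E u1 : bidual u1 -> z (fun x => u1 (T x).2) = u1 phi0.
  (* The element (u1, 0) of X''; commuting with it evaluates z2 at [u1]. *)
  move=> bu1; pose u chi := u1 (fun b => chi (i1 b)).
  have bi1 chi : blf chi -> blf (fun b => chi (i1 b)).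
    move=> bc; have [N N0 hN] := blf_bound bc.
    apply: (@blfI _ _ _ N) => [c b b'|b]; first by rewrite i1L bc.1.
    by apply: le_trans (hN _) _; rewrite ler_wpM2l.
  have [M1 M10 hM1] := bidual_bound bu1.
  have bu : bidual u.
    apply: (@bidualI _ _ u _ M1 x00) => [c phi psi bp bq|phi N bp N0 hN].
      by rewrite /u -bu1.1//; exact: bi1.
    apply: hM1 => //; first exact: bi1.
    by move=> b; apply: le_trans (hN _) _; rewrite ler_wpM2l.
  have := commuting_bilinear bz cz bu bB.
  have -> : (fun x => u (B x)) = (fun x => u1 (T x).2).
    by apply/funext => x; congr u1; apply/funext => b; rewrite B1.
  move=> ->; congr u1; apply/funext => b; congr z; apply/funext => y.
  by rewrite symB B1.
(* A functional [chi] splits into its restriction to F, handled by [za], and its restriction to F',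
   an element of F'' to which [z2E] applies. *)
exists (i1 a + i2 phi0) => chi bc.
have [N N0 hN] := blf_bound bc.
have bi1 : blf (fun b => chi (i1 b)).
  apply: (@blfI _ _ _ N) => [c b b'|b]; first by rewrite i1L bc.1.
  by apply: le_trans (hN _) _; rewrite ler_wpM2l.
have bi2 : bidual (fun phi => chi (i2 phi)).
  apply: (@bidualI _ _ _ y0 N y00) => [c phi psi bp bq|phi N' bp N'0 hN'].
    by rewrite i2L// bc.1.
  by apply: le_trans (hN _) _; rewrite ler_wpM2l// i2_le.
have -> : z chi = z (fun x => chi (i1 (T x).1) + chi (i2 (T x).2)).
  by congr z; apply/funext => x; rewrite -blfD// i1i2.
have bi2T : blf (fun x => chi (i2 (T x).2)).
  apply: (@blfI _ _ _ N) => [c x y|x].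
    rewrite -bc.1 -i2L//; congr (chi (i2 _)); apply/funext => w; exact: sndL.
  apply: le_trans (hN _) _; rewrite ler_wpM2l//; exact: i2_le.
rewrite bidualD//; last exact: bfst bi1.
by rewrite (z2E _ bi2) -[X in X + _]/(z1 (fun b => chi (i1 b))) za// -blfD.
Qed.

End Sum_with_dual.

(** * The case l_1 *)

Section Finite_sums.
Local Open Scope complex_scope.
Context {R : realType} {X : normedModType R[i]}.

Lemma blf_sum (c : nat -> R[i]) (phi : nat -> X -> CC R) N :
  (forall k, blf (phi k)) -> blf (fun x => \sum_(k < N) c k *: phi k x).
Proof.
move=> bp; elim: N => [|N IH].
  by under eq_fun do rewrite big_ord0; exact: blf_cst0.
under eq_fun do rewrite big_ord_recr /=.
by apply: blfDf => //; exact: blfZf.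
Qed.

Lemma bidual_sum z (c : nat -> R[i]) (phi : nat -> X -> CC R) N : bidual z ->
  (forall k, blf (phi k)) ->
  z (fun x => \sum_(k < N) c k *: phi k x) = \sum_(k < N) c k *: z (phi k).
Proof.
move=> bz bp; elim: N => [|N IH].
  by rewrite big_ord0 -[RHS](bidual0 bz); congr z; apply/funext => x; rewrite big_ord0.
rewrite big_ord_recr /= -IH -bidualZ// -bidualD//; last 2 first.
- exact: blf_sum.
- exact: blfZf.
by congr z; apply/funext => x; rewrite big_ord_recr.
Qed.

(** Monotone convergence is carried out on real parts and transported back to the complex
    numbers. *)
Lemma nneg_series_cvg (s : nat -> CC R) (C : R[i]) :
  (forall N, \sum_(n < N) `|s n| <= C) ->
  cvgn (series (fun n => (`|s n| : CC R))).
Proof.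
move=> sC; pose r N : R := Re (\sum_(n < N) `|s n|).
have rE N : (r N)%:C = \sum_(n < N) `|s n| by apply: ge0_Re; exact: sumr_ge0.
have CE : (Re C)%:C = C by apply: ge0_Re; have := sC 0%N; rewrite big_ord0.
have cr : cvgn r.
  apply: nondecreasing_is_cvgn.
    apply/nondecreasing_seqP => n.
    by rewrite -lecR !rE big_ord_recr /= lerDl.
  by exists (Re C) => _ [n _ <-]; rewrite -lecR rE CE.
apply/cvg_ex; exists (limn r)%:C; apply/cvgrPdist_lt => e e0.
have eE : (Re e)%:C = e by apply: ge0_Re; exact: ltW.
have e1 : 0 < Re e by rewrite -ltcR eE.
have /cvgrPdist_lt /(_ _ e1)[N _ hN] := cr.
exists N => // n Nn; rewrite /series /= big_mkord -rE -eE.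
have -> : (limn r)%:C - (r n)%:C = (limn r - r n)%:C by rewrite [RHS]rmorphB.
rewrite normc_def /= expr0n /= addr0 sqrtr_sqr ltcR; exact: hN.
Qed.

End Finite_sums.

(** * Coordinates, unit vectors and functionals on l_1 *)

Section Ell1.
Local Open Scope complex_scope.
Context {R : realType} {X : normedModType R[i]}.
Variable T : X -> nat -> CC R.
Hypothesis TL : forall (a : R[i]) (x y : X),
  T (a *: x + y) = (fun n => a *: T x n + T y n).
Hypothesis TN : forall x : X, cvgn (series (fun n => (`|T x n| : CC R))) /\
  (`|x| : CC R) = limn (series (fun n => (`|T x n| : CC R))).
Hypothesis TS : forall s : nat -> CC R,
  cvgn (series (fun n => (`|s n| : CC R))) -> exists x : X, T x = s.

Let TLn (a : R[i]) x y n : T (a *: x + y) n = a *: T x n + T y n.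
Proof. by rewrite TL. Qed.

Lemma ell1_tail x (e : R[i]) : 0 < e -> exists N, forall n, (N <= n)%N ->
  `|x| < \sum_(k < n) `|T x k| + e /\ \sum_(k < n) `|T x k| < `|x| + e.
Proof.
move=> e0; have [cx nx] := TN x.
have /cvgrPdist_lt /(_ e e0)[N _ hN] := cx; rewrite -nx in hN.
exists N => n /hN; rewrite /series /= big_mkord.
have sr : `|x| - \sum_(k < n) `|T x k| \is Num.real.
  by rewrite realB// ger0_real// sumr_ge0.
by rewrite real_ltr_norml// ltrBlDl ltrBrDl ltrBlDr => /andP[].
Qed.

Lemma ell1_partial_le x N : \sum_(k < N) `|T x k| <= `|x|.
Proof.
apply/ler_addgt0Pr => e e0; have [N' hN'] := ell1_tail x e0.
have [_ /ltW] := hN' _ (leq_maxr N N'); apply: le_trans.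
rewrite -!(big_mkord xpredT (fun k => `|T x k|)).
by rewrite [leRHS](big_cat_nat _ (leq_maxl N N'))//= lerDl sumr_ge0.
Qed.

Lemma ell1_norm_le x (C : R[i]) :
  (forall N, \sum_(k < N) `|T x k| <= C) -> `|x| <= C.
Proof.
move=> xC; apply/ler_addgt0Pr => e e0; have [N hN] := ell1_tail x e0.
by have [/ltW/le_trans->//] := hN N (leqnn N); rewrite lerD2r.
Qed.

(** Source of the vectors with prescribed coordinates below; only finite sums then have to be
    estimated. *)
Lemma ell1_surj (s : nat -> CC R) (C : R[i]) :
  (forall N, \sum_(k < N) `|s k| <= C) -> exists2 x, T x = s & `|x| <= C.
Proof.
move=> sC; have [x Tx] := TS (nneg_series_cvg sC).
by exists x => //; apply: ell1_norm_le; rewrite Tx.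
Qed.

Lemma ell1_inj x y : (forall n, T x n = T y n) -> x = y.
Proof.
move=> xy; apply/esym/eqP; rewrite -subr_eq0 -normr_le0; apply: ell1_norm_le => N.
rewrite big1// => k _.
by rewrite -scaleN1r addrC TLn xy scaleN1r addNr normr0.
Qed.

Lemma ell1_coord_le x n : `|T x n| <= `|x|.
Proof.
by apply: le_trans (ell1_partial_le x n.+1); rewrite big_ord_recr /= lerDr sumr_ge0.
Qed.

Lemma blf_coord n : blf (fun x => T x n).
Proof. by apply: (@blfI _ _ _ 1) => [a x y|x]; rewrite ?TLn// mul1r ell1_coord_le. Qed.

Lemma sum_pred1_le1 (s : nat -> R[i]) (i N : nat) :
  (forall k, k != i -> s k = 0) -> 0 <= s i -> \sum_(k < N) s k <= s i.
Proof.
move=> s0 si; have [iN|Ni] := ltnP i N.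
  by rewrite (bigD1 (Ordinal iN))//= big1 ?addr0// => k ki; rewrite s0.
rewrite big1// => k _; apply: s0; rewrite neq_ltn (leq_trans (ltn_ord k))//.
Qed.

Lemma ell1_basis : exists e : nat -> X,
  (forall i n, T (e i) n = (n == i)%:R) /\ forall i, `|e i| <= 1.
Proof.
have /choice[e he] (i : nat) : exists x : X, T x = (fun n => (n == i)%:R) /\ `|x| <= 1.
  have [|x Tx x1] := @ell1_surj (fun n => (n == i)%:R) 1; last by exists x.
  move=> N; apply: le_trans (@sum_pred1_le1 (fun n => `|(n == i)%:R|) i N _ _) _ => //.
    by move=> k /negbTE ->; rewrite normr0.
  by rewrite /= eqxx normr1.
by exists e; split=> [i n|i]; have [h1 h2] := he i; rewrite ?h1.
Qed.

Variable e : nat -> X.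
Hypothesis Te : forall i n, T (e i) n = (n == i)%:R.
Hypothesis e_le1 : forall i, `|e i| <= 1.

Let T0 n : T 0 n = 0. Proof. exact: blf0x (blf_coord n). Qed.

Lemma coord_basis_sum (c : nat -> R[i]) N n :
  T (\sum_(k < N) c k *: e k) n = if (n < N)%N then c n else 0.
Proof.
elim: N => [|N IH]; first by rewrite big_ord0 T0.
rewrite big_ord_recr /= addrC TLn IH Te ltnS [(n <= N)%N]leq_eqVlt.
have [->|nN] := eqVneq n N; last by rewrite /= scaler0 add0r.
by rewrite ltnn addr0 -[_ *: _]/(_ * _) mulr1.
Qed.

Lemma blf_basis_sum (phi : X -> CC R) (c : nat -> R[i]) N : blf phi ->
  phi (\sum_(k < N) c k *: e k) = \sum_(k < N) c k * phi (e k).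
Proof.
move=> bp; elim: N => [|N IH]; first by rewrite !big_ord0 (blf0x bp).
by rewrite !big_ord_recr /= blfD// blfZ// IH.
Qed.

(** Part of the identification of the dual of l_1 with l_oo: on a truncation of [x] the estimate is
    a finite sum, and boundedness of [phi] controls the small remainder. *)
Lemma blf_sup_bound (phi : X -> CC R) (c : R[i]) : blf phi -> 0 <= c ->
  (forall n, `|phi (e n)| <= c) -> forall x, `|phi x| <= c * `|x|.
Proof.
move=> bp c0 hc x; have [M M0 hM] := blf_bound bp.
apply/ler_addgt0Pr => d d0.
have M1 : 0 < M + 1 by rewrite ltr_wpDl.
have [N hN] := ell1_tail x (divr_gt0 d0 M1).
pose y := \sum_(k < N) T x k *: e k.
have -> : phi x = phi y + phi (x - y) by rewrite -blfD// addrC subrK.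
apply: le_trans (ler_normD _ _) _; apply: lerD.
  rewrite /y blf_basis_sum//; apply: le_trans (ler_norm_sum _ _ _) _.
  apply: le_trans (_ : c * \sum_(k < N) `|T x k| <= _); last first.
    by rewrite ler_wpM2l//; exact: ell1_partial_le.
  rewrite mulr_sumr; apply: ler_sum => k _.
  by rewrite normrM mulrC ler_wpM2r.
apply: le_trans (hM _) _.
have yd : `|x - y| <= d / (M + 1).
  apply: ell1_norm_le => N'.
  have Txy k : `|T (x - y) k| = if (k < N)%N then 0 else `|T x k|.
    rewrite -scaleN1r addrC TLn coord_basis_sum.
    case: ifP => _; last by rewrite scaler0 add0r.
    by rewrite scaleN1r addNr normr0.
  under eq_bigr do rewrite Txy.
  pose m := maxn N N'.
  apply: le_trans (_ : \sum_(k < m) (if (k < N)%N then 0 else `|T x k|) <= _).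
    rewrite -!(big_mkord xpredT (fun k => if (k < N)%N then 0 else `|T x k|)).
    rewrite [leRHS](big_cat_nat _ (leq_maxr N N'))//= lerDl sumr_ge0// => k _.
    by case: ifP.
  (* Adding the first [N] terms completes the tail to a partial sum of the norm, which [hN] compares
     with those same terms. *)
  rewrite -(lerD2l (\sum_(k < N) `|T x k|)).
  apply: le_trans (_ : `|x| <= _); last by have [/ltW] := hN N (leqnn N).
  apply: le_trans (ell1_partial_le x m).
  rewrite -(big_mkord xpredT (fun k => if (k < N)%N then 0 else `|T x k|)).
  rewrite -!(big_mkord xpredT (fun k => `|T x k|)).
  rewrite [X in _ + X <= _](big_cat_nat _ (leq_maxl N N'))//=.
  rewrite [leRHS](big_cat_nat _ (leq_maxl N N'))//= lerD2l.
  rewrite big_nat big1 ?add0r; last by move=> k /andP[_ ->].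
  by rewrite big_nat [leRHS]big_nat ler_sum// => k /andP[Nk _]; rewrite ltnNge Nk.
apply: le_trans (_ : M * (d / (M + 1)) <= _); first by rewrite ler_wpM2l.
rewrite mulrCA -[leRHS]mulr1 ler_wpM2l//; first exact: ltW.
by rewrite ler_pdivrMr// mul1r lerDl.
Qed.

Lemma blf_eq_basis (phi psi : X -> CC R) : blf phi -> blf psi ->
  (forall n, phi (e n) = psi (e n)) -> phi = psi.
Proof.
move=> bp bq pq; apply/funext => x; apply/eqP; rewrite -subr_eq0 -normr_le0.
rewrite -(mul0r `|x|).
have bd : blf (fun x => phi x - psi x).
  by have := blf_lin (-1) bq bp; under eq_fun do rewrite addrC scaleN1r.
by apply: (blf_sup_bound bd) => // n; rewrite pq subrr normr0.
Qed.

(** A coordinate projection; composing with it multiplies a functional by the indicator of [b]. *)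
Lemma ell1_multiplier (b : nat -> bool) : exists m : X -> X,
  [/\ forall x n, T (m x) n = (b n)%:R * T x n,
      forall (a : R[i]) x y, m (a *: x + y) = a *: m x + m y &
      forall x, `|m x| <= `|x| ].
Proof.
have /choice[m hm] (x : X) : exists y,
    T y = (fun n => (b n)%:R * T x n) /\ `|y| <= `|x|.
  have [|y Ty yx] := @ell1_surj (fun n => (b n)%:R * T x n) `|x|; last by exists y.
  move=> N; apply: le_trans (ell1_partial_le x N); apply: ler_sum => k _.
  by case: (b k); rewrite ?mul1r// mul0r normr0.
have Tm x n : T (m x) n = (b n)%:R * T x n by rewrite (hm x).1.
exists m; split=> // [a x y|x]; last exact: (hm x).2.
apply: ell1_inj => n; rewrite Tm !TLn !Tm mulrDr; congr (_ + _).
by rewrite -[_ *: T x n]/(_ * _) -[_ *: (_ * _)]/(_ * (_ * _)) mulrCA.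
Qed.

(* The convolution of the semigroup (nat, max): partial sums are multiplied. *)
Lemma ell1_max_product : exists mul : X -> X -> X,
  [/\ forall x y n, T (mul x y) n = T x n * T y n
        + T x n * (\sum_(k < n) T y k) + (\sum_(k < n) T x k) * T y n,
      forall x y, mul x y = mul y x,
      forall (a : R[i]) x y y', mul x (a *: y + y') = a *: mul x y + mul x y' &
      forall x y, `|mul x y| <= 3 * `|x| * `|y| ].
Proof.
(* The pairs of indices with maximum [n]: both equal to [n], only the first, or only the second. *)
pose s x y n : CC R := T x n * T y n
  + T x n * (\sum_(k < n) T y k) + (\sum_(k < n) T x k) * T y n.
have psum_le x n : `|\sum_(k < n) T x k| <= `|x|.
  by apply: le_trans (ler_norm_sum _ _ _) _; exact: ell1_partial_le.
(* Two terms are charged to coordinate [n] of [x] and one to that of [y]; summing over [n] gives the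
   constant 3. *)
have s_le x y n : `|s x y n| <= `|T x n| * `|y| *+ 2 + `|x| * `|T y n|.
  apply: le_trans (ler_normD _ _) _; apply: lerD.
    apply: le_trans (ler_normD _ _) _; rewrite !normrM mulr2n.
    by apply: lerD; rewrite ler_wpM2l// ell1_coord_le.
  by rewrite normrM ler_wpM2r.
have /choice[f hf] (p : X * X) :
    exists w : X, T w = s p.1 p.2 /\ `|w| <= 3 * `|p.1| * `|p.2|.
  case: p => x y /=.
  have [|w Tw ww] := @ell1_surj (s x y) (3 * `|x| * `|y|); last by exists w.
  move=> N; apply: le_trans (_ :
    \sum_(k < N) (`|T x k| * `|y| *+ 2 + `|x| * `|T y k|) <= _).
    by apply: ler_sum => k _.
  rewrite big_split/= -mulr_sumr sumrMnl -mulr_suml.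
  rewrite (_ : 3 * `|x| * `|y| = `|x| * `|y| *+ 2 + `|x| * `|y|); last by ring.
  apply: lerD; last by rewrite ler_wpM2l// ell1_partial_le.
  by rewrite lerMn2r /= ler_wpM2r// ell1_partial_le.
pose mul x y := f (x, y).
have Tmul x y n : T (mul x y) n = s x y n by rewrite /mul (hf (x, y)).1.
exists mul; split=> //.
- by move=> x y; apply: ell1_inj => n; rewrite !Tmul /s; ring.
- move=> a x y y'; apply: ell1_inj => n; rewrite TLn !Tmul /s TLn.
  under eq_bigr do rewrite TLn.
  rewrite big_split/= -scaler_sumr.
  rewrite -![_ *: _]/(_ * _); ring.
- by move=> x y; exact: (hf (x, y)).2.
Qed.

(** The infimum of such [c] is the upper limit of the moduli of [phi] along the unit vectors indexed
    by [sigma]. *)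
Definition basis_limit_bound (sigma : nat -> nat) (phi : X -> CC R) (c : R) : Prop :=
  0 <= c /\ exists N, forall n, (N <= n)%N -> `|phi (e (sigma n))| <= c%:C.

(** Hahn-Banach for the upper-limit seminorm along [sigma]: it is at least [d] at [phi], and 0 on
    whatever vanishes eventually along [sigma]. *)
Lemma generalized_limit (sigma : nat -> nat) (phi : X -> CC R) (d : R) :
  blf phi -> 0 < d ->
  (forall N, exists2 n, (N <= n)%N & d%:C <= `|phi (e (sigma n))|) ->
  exists u, [/\ bidual u, u phi != 0 &
    forall psi N, (forall n, (N <= n)%N -> psi (e (sigma n)) = 0) -> u psi = 0].
Proof.
move=> bp d0 phid; pose B := basis_limit_bound sigma.
have ReE (c : R[i]) : 0 <= c -> (Re c)%:C = c by exact: ge0_Re.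
have B0 v c : B v c -> 0 <= c by case.
have BD v w c c' : B v c -> B w c' -> B (v + w) (c + c').
  move=> [c0 [N hN]] [c'0 [N' hN']]; split; first exact: addr_ge0.
  exists (maxn N N') => n; rewrite geq_max => /andP[Nn N'n].
  rewrite realcD; apply: le_trans (ler_normD _ _) _.
  by apply: lerD; [exact: hN|exact: hN'].
have BZ (a : R[i]) v c : B v c -> B (a *: v) (Re `|a| * c).
  move=> [c0 [N hN]]; split; first by rewrite mulr_ge0// -ler0c ReE.
  by exists N => n /hN ?; rewrite normrM realcM ReE// ler_wpM2l.
have bB psi M : 0 <= M -> (forall x, `|psi x| <= M * `|x|) -> B psi (Re M).
  move=> M0 hM; split; first by rewrite -ler0c ReE.
  exists 0%N => n _; rewrite ReE//; apply: le_trans (hM _) _.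
  by rewrite ler_piMr.
have [M M0 hM] := blf_bound bp.
have [|u [uL ule ud]] := Hahn_Banach_gauge B0 BD BZ (bB _ _ M0 hM) (d := d).
  move=> c [c0 [N hN]]; have [n Nn dn] := phid N.
  by rewrite -lecR; apply: le_trans dn _; exact: hN.
exists u; split.
- have e0 : e 0%N != 0.
    apply/eqP => e00; have := Te 0 0; rewrite e00 T0 /= => /eqP.
    by rewrite eq_sym oner_eq0.
  apply: (@bidualI _ _ u _ 1 e0) => [a psi chi bpsi bchi|psi N bpsi N0 hN].
    have [M1 M10 hM1] := blf_bound bpsi; have [M2 M20 hM2] := blf_bound bchi.
    by rewrite -[RHS]uL//; [exists (Re M1)|exists (Re M2)]; exact: bB.
  by rewrite mul1r -[leRHS]ReE//; apply: ule; exact: bB.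
- by rewrite -normr_gt0; apply: lt_le_trans ud; rewrite ltcR.
- move=> psi N hN; apply/eqP; rewrite -normr_le0; apply: (ule psi 0); split=> //.
  by exists N => n /hN ->; rewrite normr0.
Qed.

(* The l_1 part of a functional on l_oo is removed by subtracting its values on
   the coordinates. *)
Lemma singular_part (z : (X -> CC R) -> CC R) : bidual z -> exists x0 : X,
  forall n, z (fun x => T x n) = T x0 n.
Proof.
move=> bz; have [M M0 hM] := bidual_bound bz.
have [|x0 Tx0 _] := @ell1_surj (fun n => z (fun x => T x n)) M; last first.
  by exists x0 => n; rewrite Tx0.
move=> N; pose s n : R[i] := z (fun x => T x n).
(* Phases turning [s n] into its modulus, with value 0 where [s n = 0]. The functional with these
   coefficients has norm at most 1, so [M] bounds the sum. *)
pose c n : R[i] := `|s n| / s n.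
have c1 n : `|c n| <= 1.
  rewrite /c; have [->|sn] := eqVneq (s n) 0; first by rewrite normr0 mul0r normr0.
  by rewrite normrM normfV normr_id mulfV// normr_eq0.
have cs n : c n * s n = `|s n|.
  by rewrite /c; have [->|sn] := eqVneq (s n) 0; rewrite ?mulr0 ?normr0// divfK.
pose psi x := \sum_(k < N) c k *: T x k.
have zpsi : z psi = \sum_(k < N) `|s k|.
  by rewrite /psi (bidual_sum c N bz blf_coord); apply: eq_bigr => k _; exact: cs.
have bpsi : blf psi := blf_sum c N blf_coord.
have psi1 x : `|psi x| <= 1 * `|x|.
  rewrite mul1r; apply: le_trans (ell1_partial_le x N).
  apply: le_trans (ler_norm_sum _ _ _) _; apply: ler_sum => k _.
  by rewrite normrM ler_piMl.
have := hM _ _ bpsi ler01 psi1; rewrite mulr1 zpsi; apply: le_trans.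
by rewrite ger0_norm// sumr_ge0.
Qed.

(** As [w] kills the coordinates, [psi] may be made to vanish on the first [N] unit vectors without
    changing [w psi]. *)
Lemma singular_bound (w : (X -> CC R) -> CC R) (M : R[i]) psi (N : nat) (c : R[i]) :
  bidual w ->
  (forall phi (K : R[i]), blf phi -> 0 <= K -> (forall x, `|phi x| <= K * `|x|) ->
    `|w phi| <= M * K) ->
  (forall n, w (fun x => T x n) = 0) -> blf psi -> 0 <= c ->
  (forall n, (N <= n)%N -> `|psi (e n)| <= c) -> `|w psi| <= M * c.
Proof.
move=> bw hM w0 bpsi c0 hN.
pose tau x : CC R := \sum_(k < N) psi (e k) *: T x k.
have btau : blf tau := blf_sum (fun k => psi (e k)) N blf_coord.
have wtau : w tau = 0.
  rewrite /tau (bidual_sum (fun k => psi (e k)) N bw blf_coord) big1// => k _.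
  by rewrite w0 scaler0.
have -> : w psi = w (fun x => psi x - tau x) by rewrite bidualB// wtau subr0.
have bd : blf (fun x => psi x - tau x).
  by have := blf_lin (-1) btau bpsi; under eq_fun do rewrite addrC scaleN1r.
apply: hM => //; apply: blf_sup_bound => // n.
have -> : tau (e n) = if (n < N)%N then psi (e n) else 0.
  rewrite /tau; have [nN|Nn] := ltnP n N.
    rewrite (bigD1 (Ordinal nN))//= Te eqxx big1 ?addr0; last first.
      move=> k kn; rewrite Te (_ : (_ == _) = false) ?scaler0//.
      by apply/negbTE; rewrite -val_eqE in kn.
    by rewrite -[_ *: _]/(_ * _) mulr1.
  rewrite big1// => k _; rewrite Te (_ : (_ == _) = false) ?scaler0//.
  by apply/negbTE; rewrite neq_ltn (leq_trans (ltn_ord k))//.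
by have [nN|Nn] := ltnP n N; [rewrite subrr normr0|rewrite subr0 hN].
Qed.

(** * Commuting elements of the bidual of l_1 *)

Lemma ell1_commuting (z : (X -> CC R) -> CC R) :
  bidual z -> commuting z -> in_canonical_image z.
Proof.
move=> bz cz; have [x0 zx0] := singular_part bz.
pose w psi := z psi - psi x0.
have [M M0 hM] := bidual_bound bz.
have e0 : e 0%N != 0.
  apply/eqP => e00; have := Te 0 0; rewrite e00 T0 /= => /eqP.
  by rewrite eq_sym oner_eq0.
have wM phi (K : R[i]) : blf phi -> 0 <= K -> (forall x, `|phi x| <= K * `|x|) ->
    `|w phi| <= (M + `|x0|) * K.
  move=> bp K0 hK; apply: le_trans (ler_normB _ _) _.
  by rewrite mulrDl; apply: lerD; [exact: hM|rewrite mulrC; exact: hK].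
have bw : bidual w.
  apply: (@bidualI _ _ w _ (M + `|x0|) e0) => // a phi psi bp bq.
  by rewrite /w bz.1// scalerBr; rewrite -[_ *: phi x0]/(_ * _); ring.
have w0 n : w (fun x => T x n) = 0 by rewrite /w zx0 subrr.
suff w_eq0 : forall phi, blf phi -> w phi = 0.
  by exists x0 => phi bp; apply/eqP; rewrite -subr_eq0; apply/eqP; exact: w_eq0.
have [mul [Tmul mulC mulL mul_le]] := ell1_max_product.
have mul_basis i j : (i < j)%N -> mul (e i) (e j) = e j.
  move=> ij; apply: ell1_inj => n; rewrite Tmul !Te.
  have -> : \sum_(k < n) T (e i) k = (i < n)%:R :> CC R.
    have [lin|nli] := ltnP i n.
      rewrite (bigD1 (Ordinal lin))//= Te eqxx big1 ?addr0// => k kn.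
      rewrite Te (_ : (_ == _) = false)//.
      by apply/negbTE; rewrite -val_eqE in kn.
    rewrite big1// => k _; rewrite Te (_ : (_ == _) = false)//.
    by apply/negbTE; rewrite neq_ltn (leq_trans (ltn_ord k)).
  have [->|nj] := eqVneq n j.
    rewrite ij mul1r (_ : (j == i) = false) ?mul0r ?add0r//.
    by apply/negbTE; rewrite neq_ltn ij orbT.
  rewrite !mulr0 addr0 add0r; have [ni|ni] := eqVneq n i; last by rewrite mul0r.
  rewrite big1 ?mulr0// => k _; rewrite Te (_ : (_ == _) = false)//.
  by apply/negbTE; rewrite neq_ltn (ltn_trans (ltn_ord k))// ni.
pose B phi x y : CC R := phi (mul x y).
have bB phi : blf phi -> bounded_symmetric_bilinear (B phi).
  move=> bp; have [K K0 hK] := blf_bound bp.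
  split=> [x y|a x y y'|]; first by rewrite /B mulC.
    by rewrite /B mulL bp.1.
  exists (K * 3) => [|x y]; first by rewrite mulr_ge0.
  by apply: le_trans (hK _) _; rewrite -!mulrA ler_wpM2l// mulrA.
(* Stands for vanishing on c_0, tested on sequences of finite support. *)
pose tail_killing (u : (X -> CC R) -> CC R) :=
  forall psi N, blf psi -> (forall n, (N <= n)%N -> psi (e n) = 0) -> u psi = 0.
have tw : tail_killing w.
  move=> psi N bpsi hN; apply/eqP; rewrite -normr_le0 -(mulr0 (M + `|x0|)).
  by apply: (singular_bound (N := N)) => // n /hN ->; rewrite normr0.
have u_basis u phi i : bidual u -> tail_killing u -> blf phi ->
    u (B phi (e i)) = u phi.
  move=> bu tu bp; have bBi := blf_bilinear (bB _ bp) (e i).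
  apply/eqP; rewrite -subr_eq0 -bidualB//; apply/eqP; apply: (tu _ i.+1).
    by have := blf_lin (-1) bp bBi; under eq_fun do rewrite addrC scaleN1r.
  by move=> n lin; rewrite /B mul_basis// subrr.
(* Evaluation at [x0] commutes with every [u] by symmetry of the form, so commutation passes from
   [z] to [w]. *)
have w_comm u phi : bidual u -> blf phi ->
    w (fun x => u (B phi x)) = u (fun x => w (B phi x)).
  move=> bu bp; have bBp := bB _ bp.
  have bu1 := blf_bidual_bilinear bBp bu.
  rewrite {1}/w (commuting_bilinear bz cz bu bBp) /w bidualB//.
  - by congr (_ - u _); apply/funext => y; rewrite /B mulC.
  - exact: blf_bidual_bilinear.
  - exact: blf_bilinear_l.
move=> phi bphi.
(* If [phi] lies in c_0, then [singular_bound] makes [w phi] arbitrarily small; otherwise its values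
   on the unit vectors stay away from 0 infinitely often. *)
have [phi_c0|] := pselect (forall d : R, 0 < d ->
    exists N, forall n, (N <= n)%N -> `|phi (e n)| <= d%:C).
  apply/eqP; rewrite -normr_le0; apply/ler_addgt0Pr => d d0; rewrite add0r.
  have M1 : 0 < M + `|x0| + 1 by rewrite ltr_wpDl// addr_ge0.
  have dE : (Re (d / (M + `|x0| + 1)))%:C = d / (M + `|x0| + 1).
    by apply: ge0_Re; rewrite divr_ge0// ltW.
  have [N hN] := phi_c0 (Re (d / (M + `|x0| + 1))) ltac:(by rewrite -ltcR dE divr_gt0).
  apply: le_trans (singular_bound bw wM w0 bphi _ hN) _.
    by rewrite dE divr_ge0// ltW.
  rewrite dE mulrCA -[leRHS]mulr1 ler_wpM2l//; first exact: ltW.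
  by rewrite ler_pdivrMr// mul1r lerDl.
move=> /existsNP[d /not_implyP[d0 /forallNP phi_d]].
have {}phi_d N : exists2 n, (N <= n)%N & d%:C <= `|phi (e n)|.
  have /existsNP[n /not_implyP[Nn /negP phin]] := phi_d N.
  exists n => //; apply: ltW; rewrite real_ltNge//.
  by apply/complex_realP; exists d.
(* This generalized limit serves to construct [one], which is why it must not vanish at [phi]. *)
have [u [bu uphi tu]] := generalized_limit (sigma := id) bphi d0 phi_d.
(* The functional one(x) = sum_n x_n, without summing a complex series. *)
pose one x : CC R := (u phi)^-1 *: u (B phi x).
have bone : blf one := blfZf (u phi)^-1 (blf_bidual_bilinear (bB _ bphi) bu).
have one_basis i : one (e i) = 1.
  rewrite /one u_basis//; first by rewrite -[_ *: _]/(_ * _) mulVf.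
  by move=> psi N _; exact: tu.
(* By [u_basis] both sides take the value [v psi] at every unit vector. *)
have u_one v psi : bidual v -> tail_killing v -> blf psi ->
    (fun x => v (B psi x)) = (fun x => v psi *: one x).
  move=> bv tv bp; apply: blf_eq_basis => [||i].
  - exact: (blf_bidual_bilinear (bB _ bp) bv).
  - exact: blfZf.
  - by rewrite u_basis// one_basis -[_ *: _]/(_ * _) mulr1.
have key v psi : bidual v -> tail_killing v -> blf psi ->
    v psi * w one = w psi * v one.
  move=> bv tv bp; have := w_comm v psi bv bp.
  rewrite u_one// (u_one w)// (bidualZ _ bw)// (bidualZ _ bv)//; exact.
have [ev [Tev evL ev_le]] := ell1_multiplier (fun n => ~~ odd n).
have ev_basis i : ev (e i) = (~~ odd i)%:R *: e i.
  apply: ell1_inj => n; rewrite Tev (blfZ _ _ (blf_coord n)) Te.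
  by rewrite -[_ *: _]/(_ * _); have [->|] := eqVneq n i; rewrite ?mulr0.
pose even x := one (ev x).
have beven : blf even.
  have [K K0 hK] := blf_bound bone.
  apply: (@blfI _ _ _ K) => [a x y|x]; first by rewrite /even evL bone.1.
  by apply: le_trans (hK _) _; rewrite ler_wpM2l.
have even_basis i : even (e i) = (~~ odd i)%:R.
  by rewrite /even ev_basis blfZ// one_basis -[_ *: _]/(_ * _) mulr1.
have one_d (sigma : nat -> nat) N :
    exists2 n, (N <= n)%N & (1 : R)%:C <= `|one (e (sigma n))|.
  by exists N; rewrite ?one_basis ?normr1.
have tail_sub (sigma : nat -> nat) v : (forall n, (n <= sigma n)%N) ->
    (forall psi N, (forall n, (N <= n)%N -> psi (e (sigma n)) = 0) -> v psi = 0) ->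
    tail_killing v.
  by move=> sn tv psi N _ hN; apply: (tv _ N) => n Nn; apply: hN; exact: leq_trans (sn n).
have [u1 [bu1 u1_one tu1]] := generalized_limit bone ltr01 (one_d double).
have [u2 [bu2 u2_one tu2]] := generalized_limit bone ltr01 (one_d (succn \o double)).
have tk1 : tail_killing u1 by apply: tail_sub tu1 => n; rewrite -addnn leq_addr.
have tk2 : tail_killing u2.
  by apply: tail_sub tu2 => n /=; rewrite -addnn leqW// leq_addr.
have u1_even : u1 even = u1 one.
  apply/eqP; rewrite -subr_eq0 -bidualB//; apply/eqP; apply: (tu1 _ 0%N) => n _.
  by rewrite even_basis one_basis odd_double subrr.
have u2_even : u2 even = 0.
  by apply: (tu2 _ 0%N) => n _; rewrite even_basis /= odd_double.
(* With [u2] the relation [key] gives [w even = 0]; with [u1] it then gives [w one = 0], and a last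
   use at [phi] gives [w phi = 0]. *)
have w_even1 := key _ _ bu1 tk1 beven; have w_even2 := key _ _ bu2 tk2 beven.
have w_even : w even = 0.
  by move/eqP: w_even2; rewrite u2_even mul0r eq_sym mulf_eq0 (negbTE u2_one) orbF => /eqP.
have w_one : w one = 0.
  by move/eqP: w_even1; rewrite w_even mul0r u1_even mulf_eq0 (negbTE u1_one) => /eqP.
have /eqP := key _ _ bu1 tk1 bphi.
by rewrite w_one mulr0 eq_sym mulf_eq0 (negbTE u1_one) orbF => /eqP.
Qed.

End Ell1.

Theorem theorem2p2 (R : realType) (X : normedModType R[i]) :
  (is_ell1 X \/
   exists F : completeNormedModType R[i], @non_reflexive R F /\ is_sum_with_dual X F) ->
  forall z : (X -> CC R) -> CC R, bidual z ->
  (forall u : (X -> CC R) -> CC R, bidual u ->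
     forall f : X -> CC R, Hb f ->
       convolution (tdelta z) (tdelta u) f = convolution (tdelta u) (tdelta z) f) ->
  in_canonical_image z.
Proof.
move=> [[T [TL [TN TS]]]|[F [nrF sumF]]] z bz cz.
  have [e [Te e_le1]] := ell1_basis TN TS.
  exact: (ell1_commuting TL TN TS Te e_le1 bz cz).
exact: (sum_with_dual_commuting nrF sumF bz cz).
Qed.
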